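(* Let $(\mathcal M,g)$ be a conformally recurrent pseudo-Riemannian manifold of dimension $n\ge 5$ with recurrence vector $\alpha_i$. Then the tensors $\alpha_i\alpha_j$, $\nabla_i\alpha_j+\nabla_j\alpha_i+R_{ij}$ and $\nabla_i\alpha_j-\nabla_j\alpha_i+\frac{n-4}{n-2}R_{ij}$ are Weyl compatible, i.e. $$\alpha_i\alpha_m C_{jkl}{}^m+\alpha_j\alpha_m C_{kil}{}^m+\alpha_k\alpha_m C_{ijl}{}^m=0,$$ $$\left[\nabla_i\alpha_m+\nabla_m\alpha_i+R_{im}\right]C_{jkl}{}^m+\text{cyclic}=0,$$ $$\left[\nabla_i\alpha_m-\nabla_m\alpha_i+\tfrac{n-4}{n-2}R_{im}\right]C_{jkl}{}^m+\text{cyclic}=0,$$ where ''cyclic'' denotes the terms obtained by cyclic permutations of $ijk$. Moreover, if the recurrence vector is closed ($\nabla_i\alpha_j=\nabla_j\alpha_i$), then $\nabla_i\alpha_j$ and $R_{ij}$ are Weyl compatible, and the Ricci tensor is also Riemann compatible: $$R_{im}R_{jkl}{}^m+R_{jm}R_{kil}{}^m+R_{km}R_{ijl}{}^m=0.$$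
   Context: Manifolds are smooth, connected, Hausdorff, with a non-degenerate metric $g$ of arbitrary signature and Levi-Civita connection $\nabla$. Conventions: $[\nabla_j,\nabla_k]v_l=R_{jkl}{}^m v_m$, $R_{kl}=-R_{mkl}{}^m$ (Ricci tensor), $R=g^{ij}R_{ij}$. The Weyl tensor is $$C_{jkl}{}^m=R_{jkl}{}^m+\tfrac{1}{n-2}(\delta_j{}^mR_{kl}-\delta_k{}^mR_{jl}+R_j{}^mg_{kl}-R_k{}^mg_{jl})-R\,\frac{\delta_j{}^mg_{kl}-\delta_k{}^mg_{jl}}{(n-1)(n-2)}.$$ $(\mathcal M,g)$ is conformally recurrent if $\nabla_iC_{jklm}=\alpha_iC_{jklm}$ for a non-zero covector field $\alpha_i$, called the recurrence vector. A tensor $b_{ij}$ is Weyl compatible if $b_{im}C_{jkl}{}^m+b_{jm}C_{kil}{}^m+b_{km}C_{ijl}{}^m=0$; it is Riemann compatible if the same identity holds with the Riemann tensor in place of $C$. *)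

(* Defs.v *)
From mathcomp Require Import all_boot all_order all_algebra.
From mathcomp Require Import all_classical all_reals all_analysis.

Set Implicit Arguments.
Unset Strict Implicit.
Unset Printing Implicit Defensive.

Import Order.TTheory GRing.Theory Num.Theory.
Import numFieldNormedType.Exports.

Local Open Scope classical_set_scope.
Local Open Scope ring_scope.

Section Smoothness.
Variables (R : realType) (n : nat).
Implicit Types (f : 'rV[R]_n -> R) (U : set 'rV[R]_n).

Definition partial (i : 'I_n) f : 'rV[R]_n -> R :=
  fun x => 'D_(delta_mx 0 i) f x.

Definition partials (s : seq 'I_n) f : 'rV[R]_n -> R := foldr partial f s.

Definition smooth_on U f : Prop :=
  forall (s : seq 'I_n) (x : 'rV[R]_n), U x ->
    {for x, continuous (partials s f)} /\
    forall i : 'I_n, derivable (partials s f) x (delta_mx 0 i).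

End Smoothness.

(* The metric and covector field are given by their components in each chart   *)
(* of the atlas, subject to the tensor transformation law on overlaps.  The    *)
(* atlas need not be maximal.  [chart a] and [param a] are total functions,    *)
(* inverse to each other between the open sets [dom a] and [img a]; their      *)
(* values elsewhere are irrelevant.                                            *)
Record smoothManifold (R : realType) (n : nat) := SmoothManifold {
  carrier :> topologicalType;
  chart_index : Type;
  dom : chart_index -> set carrier;
  chart : chart_index -> carrier -> 'rV[R]_n;
  param : chart_index -> 'rV[R]_n -> carrier;
  img : chart_index -> set 'rV[R]_n := fun a => chart a @` dom a;
  transition : chart_index -> chart_index -> 'I_n -> 'rV[R]_n -> R :=
    fun a b j x => chart b (param a x) 0 j;
  carrier_hausdorff : hausdorff_space carrier;
  carrier_connected : connected [set: carrier];
  dom_cover : forall p : carrier, exists a, dom a p;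
  dom_open : forall a, open (dom a);
  img_open : forall a, open (img a);
  chartK : forall a p, dom a p -> param a (chart a p) = p;
  chart_continuous : forall a, {within dom a, continuous (chart a)};
  param_continuous : forall a, {within img a, continuous (param a)};
  transition_smooth : forall a b j,
    smooth_on (chart a @` (dom a `&` dom b)) (transition a b j)
}.

Record covectorField (R : realType) (n : nat) (M : smoothManifold R n) :=
  CovectorField {
  covec :> chart_index M -> 'I_n -> 'rV[R]_n -> R;
  covec_smooth : forall a i, smooth_on (img a) (covec a i);
  covec_transform : forall (a b : chart_index M) (p : M),
      dom a p -> dom b p -> forall i,
        covec a i (chart a p) =
        \sum_(j < n) partial i (transition a b j) (chart a p) *
                     covec b j (chart b p)
}.

Record pseudoRiemannianManifold (R : realType) (n : nat) :=
  PseudoRiemannianManifold {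
  manifold :> smoothManifold R n;
  metric : chart_index manifold -> 'rV[R]_n -> 'M[R]_n;
  metric_smooth : forall a i j, smooth_on (img a) (fun x => metric a x i j);
  metric_sym : forall a x, img a x -> (metric a x)^T = metric a x;
  metric_nondegenerate : forall a x, img a x -> metric a x \in unitmx;
  metric_transform : forall (a b : chart_index manifold) (p : manifold),
      dom a p -> dom b p -> forall i j,
        metric a (chart a p) i j =
        \sum_(k < n) \sum_(l < n)
          partial i (transition a b k) (chart a p) *
          partial j (transition a b l) (chart a p) *
          metric b (chart b p) k l
}.

Section LocalGeometry.
Variables (R : realType) (n : nat) (g : 'rV[R]_n -> 'M[R]_n).
Implicit Types (i j k l m p : 'I_n) (x : 'rV[R]_n).

Definition invg i j x : R := invmx (g x) i j.

(* christoffel m i j is Gamma^m_{ij} of the Levi-Civita connection. *)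
Definition christoffel m i j x : R :=
  2^-1 * \sum_(p < n) invg m p x *
    (partial i (fun y => g y j p) x + partial j (fun y => g y i p) x -
     partial p (fun y => g y i j) x).

(* The index of differentiation comes first: nabla2 T i j k = nabla_i T_{jk}. *)
Definition nabla1 (v : 'I_n -> 'rV[R]_n -> R) i j x : R :=
  partial i (v j) x - \sum_(m < n) christoffel m i j x * v m x.

Definition nabla2 (T : 'I_n -> 'I_n -> 'rV[R]_n -> R) i j k x : R :=
  partial i (T j k) x
  - \sum_(m < n) christoffel m i j x * T m k x
  - \sum_(m < n) christoffel m i k x * T j m x.

Definition nabla4 (T : 'I_n -> 'I_n -> 'I_n -> 'I_n -> 'rV[R]_n -> R)
    i j k l m x : R :=
  partial i (T j k l m) x
  - \sum_(p < n) christoffel p i j x * T p k l m x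
  - \sum_(p < n) christoffel p i k x * T j p l m x
  - \sum_(p < n) christoffel p i l x * T j k p m x
  - \sum_(p < n) christoffel p i m x * T j k l p x.

Definition coord_covector m : 'I_n -> 'rV[R]_n -> R :=
  fun l _ => (l == m)%:R.

(* riemann j k l m = R_{jkl}^m, read off from                                  *)
(*   [nabla_j, nabla_k] v_l = \sum_m R_{jkl}^m v_m                             *)
(* applied to the coordinate covector v = dx^m.                                *)
Definition riemann j k l m x : R :=
  nabla2 (nabla1 (coord_covector m)) j k l x
  - nabla2 (nabla1 (coord_covector m)) k j l x.

Definition ricci k l x : R := - \sum_(m < n) riemann m k l m x.

(* ricci_up j m = R_j^m *)
Definition ricci_up j m x : R := \sum_(p < n) ricci j p x * invg p m x.

Definition scalar_curvature x : R :=
  \sum_(i < n) \sum_(j < n) invg i j x * ricci i j x.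

(* weyl j k l m = C_{jkl}^m *)
Definition weyl j k l m x : R :=
  riemann j k l m x
  + (n%:R - 2)^-1 *
    ((j == m)%:R * ricci k l x - (k == m)%:R * ricci j l x
     + ricci_up j m x * g x k l - ricci_up k m x * g x j l)
  - scalar_curvature x *
    (((j == m)%:R * g x k l - (k == m)%:R * g x j l)
     / ((n%:R - 1) * (n%:R - 2))).

(* weyl_low j k l m = C_{jklm} *)
Definition weyl_low j k l m x : R :=
  \sum_(p < n) weyl j k l p x * g x p m.

(* b is compatible at x with the tensor K j k l m = K_{jkl}^m *)
Definition compatible_at (K : 'I_n -> 'I_n -> 'I_n -> 'I_n -> 'rV[R]_n -> R)
    (b : 'I_n -> 'I_n -> 'rV[R]_n -> R) x : Prop :=
  forall i j k l,
    \sum_(m < n) (b i m x * K j k l m x + b j m x * K k i l m x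
                  + b k m x * K i j l m x) = 0.

End LocalGeometry.

Section GlobalGeometry.
Variables (R : realType) (n : nat) (M : pseudoRiemannianManifold R n).
Implicit Types (alpha : covectorField M)
  (b : chart_index M -> 'I_n -> 'I_n -> 'rV[R]_n -> R).

Definition weyl_compatible b : Prop :=
  forall a x, img a x -> compatible_at (weyl (metric a)) (b a) x.

Definition riemann_compatible b : Prop :=
  forall a x, img a x -> compatible_at (riemann (metric a)) (b a) x.

(* A non-zero field is one that does not vanish identically. *)
Definition nonzero_covector alpha : Prop :=
  exists a x i, img a x /\ alpha a i x != 0.

Definition conformally_recurrent alpha : Prop :=
  nonzero_covector alpha /\
  forall a x, img a x -> forall i j k l m,
    nabla4 (metric a) (weyl_low (metric a)) i j k l m x =
    alpha a i x * weyl_low (metric a) j k l m x.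

Definition nabla_covector alpha (a : chart_index M) : 'I_n -> 'I_n -> 'rV[R]_n -> R :=
  nabla1 (metric a) (alpha a).

Definition ricci_tensor (a : chart_index M) : 'I_n -> 'I_n -> 'rV[R]_n -> R :=
  ricci (metric a).

Definition closed_covector alpha : Prop :=
  forall a x, img a x -> forall i j,
    nabla_covector alpha a i j x = nabla_covector alpha a j i x.

End GlobalGeometry.

(* Main.v *)
Require Import Defs.
From HB Require Import structures.
From mathcomp Require Import all_boot all_order all_algebra ring lra.
From mathcomp Require Import all_classical all_reals all_analysis.

Set Implicit Arguments.
Unset Strict Implicit.
Unset Printing Implicit Defensive.

Import Order.TTheory GRing.Theory Num.Theory.
Import numFieldNormedType.Exports.

Local Open Scope classical_set_scope.
Local Open Scope ring_scope.

(* In terms of the Schouten tensor [P], [C = Riem + g ^ P] (Kulkarni-Nomizu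
   product).  As [nabla g = 0], the second Bianchi identity and the recurrence
   [nabla C = alpha C] give, with [Q_jkl = nabla_j P_kl - nabla_k P_jl],
     [alpha_i C_jklm + cyc = - (g_im Q_jkl - g_il Q_jkm) + cyc].
   Contracting with [g^im] yields [alpha^m C_jklm = - (n - 3) Q_jkl], and
   contracting with [alpha^m] then gives [(n - 4)] times the first claim.
   Put [X = P_im C_jkl^m + cyc].  Differentiating the formula for [Q] and using
   the Ricci identity for [P] gives [nabla_i alpha_m C_jkl^m + cyc = - (n - 3) X];
   the Ricci identity for [C] gives
     [(nabla_i alpha_m - nabla_m alpha_i) C_jkl^m + cyc = - (n - 4) X].
   Since [R_ij] is [(n - 2) P_ij] modulo a multiple of [g_ij], which is
   compatible with every curvature-like tensor, all claims follow; if [alpha] is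
   closed, the last formula gives [X = 0].  The tensor calculus is carried out
   in the differential ring of smooth functions on the image of a chart. *)

(** * Contractions and algebraic curvature tensors *)

(* All tensors carry lower indices: the mixed contraction [b_im T_jkl^m] is
   [tr (fun m p => b i m * T j k l p)], where [H] is the inverse of the metric
   [G]. *)
Section MetricTrace.
Variables (A : comPzRingType) (n : nat) (G H : 'I_n -> 'I_n -> A).
Hypothesis Hsym : forall i j, H i j = H j i.
Hypothesis Gsym : forall i j, G i j = G j i.
Hypothesis HG : forall i k, \sum_m H i m * G m k = (i == k)%:R.

Definition tr (F : 'I_n -> 'I_n -> A) : A := \sum_i \sum_m H i m * F i m.

Lemma eq_tr F K : (forall i m, F i m = K i m) -> tr F = tr K.
Proof. by move=> e; apply: eq_bigr => i _; apply: eq_bigr => m _; rewrite e. Qed.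

Lemma trD F K : tr (fun i m => F i m + K i m) = tr F + tr K.
Proof.
rewrite -big_split; apply: eq_bigr => i _; rewrite -big_split.
by apply: eq_bigr => m _; rewrite mulrDr.
Qed.

Lemma trZ c F : tr (fun i m => c * F i m) = c * tr F.
Proof.
rewrite mulr_sumr; apply: eq_bigr => i _; rewrite mulr_sumr.
by apply: eq_bigr => m _; rewrite mulrCA.
Qed.

Lemma trN F : tr (fun i m => - F i m) = - tr F.
Proof. by rewrite -mulN1r -trZ; apply: eq_tr => i m; rewrite mulN1r. Qed.

Lemma trB F K : tr (fun i m => F i m - K i m) = tr F - tr K.
Proof. by rewrite trD trN. Qed.

Lemma trZr c F : tr (fun i m => F i m * c) = tr F * c.
Proof. by rewrite mulrC -trZ; apply: eq_tr => i m; rewrite mulrC. Qed.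

Lemma tr0 F : (forall i m, F i m = 0) -> tr F = 0.
Proof.
by move=> F0; rewrite -[RHS](mul0r (tr F)) -trZ; apply: eq_tr => i m; rewrite F0 mul0r.
Qed.

Lemma trC F : tr (fun i m => F m i) = tr F.
Proof.
rewrite /tr exchange_big; apply: eq_bigr => i _; apply: eq_bigr => m _.
by rewrite Hsym.
Qed.

Lemma sum_delta (v : 'I_n -> A) j : \sum_m (j == m)%:R * v m = v j.
Proof.
rewrite (bigD1 j) //= eqxx mul1r big1 ?addr0 // => m mj.
by rewrite eq_sym (negPf mj) mul0r.
Qed.

Lemma sum_tr (F : 'I_n -> 'I_n -> 'I_n -> A) :
  \sum_q tr (F q) = tr (fun i m => \sum_q F q i m).
Proof.
rewrite /tr exchange_big; apply: eq_bigr => i _; rewrite exchange_big.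
by apply: eq_bigr => m _; rewrite mulr_sumr.
Qed.

Lemma tr_exchange F :
  tr (fun i m => tr (fun p q => F i m p q)) =
  tr (fun p q => tr (fun i m => F i m p q)).
Proof.
rewrite {1}/tr; under eq_bigr => i _.
  under eq_bigr => m _ do rewrite -trZ.
  rewrite sum_tr; over.
by rewrite sum_tr; apply: eq_tr.
Qed.

(** The inverse metric cancels the metric, so contraction puts [j] in place of the contracted index;
    the next two lemmas only vary the slots. *)
Lemma tr_Gr (v : 'I_n -> A) j : tr (fun i m => v i * G j m) = v j.
Proof.
rewrite -[RHS]sum_delta; apply: eq_bigr => i _.
rewrite eq_sym -HG mulr_suml; apply: eq_bigr => m _.
by rewrite Gsym mulrA mulrAC.
Qed.

Lemma tr_Gl (v : 'I_n -> A) j : tr (fun i m => G j i * v m) = v j.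
Proof. by rewrite -trC -[RHS]tr_Gr; apply: eq_tr => i m; rewrite mulrC. Qed.

Lemma tr_lG (v : 'I_n -> A) j : tr (fun i m => G i j * v m) = v j.
Proof. by rewrite -[RHS]tr_Gl; apply: eq_tr => i m; rewrite Gsym. Qed.

Lemma trG : tr G = n%:R.
Proof.
rewrite /tr (eq_bigr (fun=> 1)) ?sumr_const ?card_ord // => i _.
transitivity (\sum_m H i m * G m i); last by rewrite HG eqxx.
by apply: eq_bigr => m _; rewrite Gsym.
Qed.

(** Pair symmetry is not a field: [curv_pair] derives it from these identities once 2 can be
    cancelled. *)
Record curvature_like (T : 'I_n -> 'I_n -> 'I_n -> 'I_n -> A) : Prop :=
  CurvatureLike {
  curv12 : forall j k l m, T j k l m = - T k j l m;
  curv34 : forall j k l m, T j k l m = - T j k m l;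
  curv_cyc : forall j k l m, T j k l m + T k l j m + T l j k m = 0
}.

(** The sign is the one for which the trace over the first and last slots is [(n - 2) P + tr P G];
    for the Schouten tensor this is the Ricci tensor, opposite to the same trace of the Riemann
    tensor. *)
Definition kulkarni_nomizu (P : 'I_n -> 'I_n -> A) j k l m : A :=
  G j m * P k l - G k m * P j l + P j m * G k l - P k m * G j l.

Lemma tr_kulkarni_nomizu P k l :
  tr (fun j m => kulkarni_nomizu P j k l m) = (n%:R - 2) * P k l + tr P * G k l.
Proof.
rewrite /kulkarni_nomizu trB trD trB !trZr trG.
have -> : tr (fun j m => G k m * P j l) = P k l.
  by rewrite -[RHS](tr_Gr (fun j => P j l)); apply: eq_tr => j m; rewrite mulrC.
have -> : tr (fun j m => P k m * G j l) = P k l.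
  by rewrite -[RHS](tr_lG (P k)); apply: eq_tr => j m; rewrite mulrC.
ring.
Qed.

Definition cyclic_contraction (b : 'I_n -> 'I_n -> A)
    (T : 'I_n -> 'I_n -> 'I_n -> 'I_n -> A) i j k l : A :=
  tr (fun m p => b i m * T j k l p + b j m * T k i l p + b k m * T i j l p).

Lemma curvature_likeD T U : curvature_like T -> curvature_like U ->
  curvature_like (fun j k l m => T j k l m + U j k l m).
Proof.
move=> [t12 t34 tc] [u12 u34 uc]; split=> j k l m.
- by rewrite t12 u12; ring.
- by rewrite t34 u34; ring.
- have := tc j k l m; have := uc j k l m => e1 e2.
  by rewrite -[RHS](addr0 0) -{1}e2 -e1; ring.
Qed.

Lemma curvature_like_kulkarni_nomizu P : (forall k l, P k l = P l k) ->
  curvature_like (kulkarni_nomizu P).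
Proof.
rewrite /kulkarni_nomizu => Ps; split=> j k l m; try by ring.
by rewrite (Gsym l k) (Gsym j k) (Gsym j l) (Ps l k) (Ps j k) (Ps j l); ring.
Qed.

(** Smooth functions have zero divisors in general, so cancellation is asked for positive integers
    only. *)
Hypothesis natr_regular : forall k (x : A), k.+1%:R * x = 0 -> x = 0.

Lemma double_eq0 (x : A) : x + x = 0 -> x = 0.
Proof. by move=> e; apply: (@natr_regular 1); rewrite mulr_natl mulr2n. Qed.

(** Adding the first Bianchi identities for [j k l m] and [k l m j] and subtracting those for
    [l m j k] and [m j k l] leaves twice the difference of the two sides. *)
Lemma curv_pair T (cT : curvature_like T) j k l m : T j k l m = T l m j k.
Proof.
have [s12 s34 cyc] := cT.
apply/subr0_eq/double_eq0.
have := cyc j k l m; have := cyc k l m j; have := cyc l m j k; have := cyc m j k l.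
rewrite (s34 j k m l) (s34 l m k j) (s34 k l m j) (s34 m j l k).
rewrite (s12 j l m k) (s34 l j m k) (s12 k m j l) (s34 m k j l) => e4 e3 e2 e1.
transitivity ((T j k l m + T k l j m + T l j k m)
  + (- T k l j m - T l m j k + T m k l j)
  - (T l m j k - T m j k l + T l j k m)
  - (T m j k l - T j k l m + T m k l j)); first by ring.
rewrite e1.
by move: e2 e3 e4; rewrite !opprK => -> -> ->; rewrite !subr0 addr0.
Qed.

Lemma cyclic_contractionD b c T i j k l :
  cyclic_contraction (fun i j => b i j + c i j) T i j k l =
  cyclic_contraction b T i j k l + cyclic_contraction c T i j k l.
Proof.
by rewrite -trD; apply: eq_tr => m p; ring.
Qed.

Lemma cyclic_contractionZ x b T i j k l :
  cyclic_contraction (fun i j => x * b i j) T i j k l =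
  x * cyclic_contraction b T i j k l.
Proof.
by rewrite -trZ; apply: eq_tr => m p; ring.
Qed.

(** Contraction with [G] gives [T j k l i] and its cyclic images; swapping the last pair turns the
    sum into a first Bianchi identity. *)
Lemma cyclic_contraction_metric T (cT : curvature_like T) i j k l :
  cyclic_contraction G T i j k l = 0.
Proof.
rewrite /cyclic_contraction !trD !tr_Gl.
rewrite (curv34 cT j k l i) (curv34 cT k i l j) (curv34 cT i j l k) -!opprD.
by rewrite (curv_cyc cT) oppr0.
Qed.

(* The Weyl tensor is [T + N], where [T] is the Riemann tensor and [N] the
   Kulkarni-Nomizu product of the metric with the Schouten tensor [P]. *)
Section Weyl.
Variables (T : 'I_n -> 'I_n -> 'I_n -> 'I_n -> A) (P : 'I_n -> 'I_n -> A).
Hypothesis cT : curvature_like T.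
Hypothesis Ps : forall k l, P k l = P l k.
Let N := kulkarni_nomizu P.

Definition weyl_part j k l m : A := T j k l m + N j k l m.
Let C := weyl_part.

Let cN : curvature_like N. Proof. exact: curvature_like_kulkarni_nomizu. Qed.
Lemma curvature_like_weyl_part : curvature_like C.
Proof. exact: (curvature_likeD cT cN). Qed.
Let cC := curvature_like_weyl_part.

(* The terms of [P_im N_jkl^m] not of the form [P_ab P_cd] involve
   [P_im P_j^m], which is symmetric in [i] and [j]. *)
Lemma cyclic_contraction_kulkarni_nomizu i j k l :
  cyclic_contraction P N i j k l = 0.
Proof.
have e a b c d : tr (fun m p => P a m * N b c d p) =
    P a b * P c d - P a c * P b d + tr (fun m p => P a m * P b p) * G c d
    - tr (fun m p => P a m * P c p) * G b d.
  rewrite -[P a b](tr_Gr (P a)) -[P a c](tr_Gr (P a)) -!trZr -?trD -?trB.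
  by rewrite -?trD -?trB; apply: eq_tr => m p; rewrite /N /kulkarni_nomizu; ring.
have PP a b : tr (fun m p => P a m * P b p) = tr (fun m p => P b m * P a p).
  by rewrite -trC; apply: eq_tr => m p; rewrite mulrC.
rewrite /cyclic_contraction !trD !e (PP j i) (PP k j) (PP k i).
rewrite (Ps j i) (Ps k i) (Ps k j); ring.
Qed.

(** This is the passage between Weyl and Riemann compatibility of the Schouten tensor, hence of the
    Ricci tensor. *)
Lemma cyclic_contraction_weyl_part i j k l :
  cyclic_contraction P C i j k l = cyclic_contraction P T i j k l.
Proof.
rewrite -[RHS]addr0 -(cyclic_contraction_kulkarni_nomizu i j k l) -trD.
by apply: eq_tr => m p; rewrite /C /weyl_part; ring.
Qed.

Hypothesis C_traceless : forall k l, tr (fun j m => C j k l m) = 0.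

Let C_traceless23 j m : tr (fun k l => C j k l m) = 0.
Proof.
rewrite -(C_traceless j m); apply: eq_tr => k l.
by rewrite (curv12 cC) (curv34 cC) opprK.
Qed.

Let C_traceless2 j l : tr (fun i m => C j i l m) = 0.
Proof.
rewrite -[RHS]oppr0 -(C_traceless j l) -trN; apply: eq_tr => k m.
exact: curv12.
Qed.

(** Here [d = n - 5], so that [n - 4] is the successor of [d] and can be cancelled by
    [natr_regular]. *)
Variable d : nat.
Hypothesis n_eq : n = d.+1.+4.

Let n_eqR : n%:R = d%:R + 5 :> A.
Proof. by rewrite n_eq !mulrS; ring. Qed.

(** * Contractions of the second Bianchi identity for a recurrent Weyl tensor *)

Section Divergence.
(** [a] stands for the recurrence vector and [Q] for the curl of the Schouten tensor, that is, the
    Cotton tensor. *)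
Variables (a : 'I_n -> A) (Q : 'I_n -> 'I_n -> 'I_n -> A).
Hypothesis Q_skew : forall j k l, Q j k l = - Q k j l.
Hypothesis recurrent_bianchi : forall i j k l m,
  a i * C j k l m + a j * C k i l m + a k * C i j l m =
  - (G i m * Q j k l + G j m * Q k i l + G k m * Q i j l)
  + (G i l * Q j k m + G j l * Q k i m + G k l * Q i j m).

(** By recurrence, [a^m C_jklm] equals the divergence [nabla^m C_jklm]. *)
Definition weyl_divergence j k l := tr (fun m p => a m * C j k l p).

(** Contracting [recurrent_bianchi] over [i] and [m] gives the formula up to the trace [q] of [Q]. A
    second trace, for which the left side vanishes because [C] is traceless, forces [q = 0]. *)
Lemma weyl_divergenceE j k l : weyl_divergence j k l = - (n%:R - 3) * Q j k l.
Proof.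
pose q k := tr (fun i m => Q k i m).
have q2 r : tr (fun i m => Q i r m) = - q r.
  by rewrite -trN; apply: eq_tr => i m; exact: Q_skew.
have e j' k' l' : weyl_divergence j' k' l' =
    - (n%:R - 3) * Q j' k' l' + G j' l' * q k' - G k' l' * q j'.
  transitivity (tr (fun i m =>
      a i * C j' k' l' m + a j' * C k' i l' m + a k' * C i j' l' m)).
    by rewrite !trD !trZ C_traceless2 C_traceless !mulr0 !addr0.
  rewrite (eq_tr (fun i m => recurrent_bianchi i j' k' l' m)).
  rewrite trD trN !trD !trZ !trZr trG q2.
  have -> : tr (fun i m => G j' m * Q k' i l') = Q k' j' l'.
    by rewrite -[RHS](tr_Gr (fun i => Q k' i l')); apply: eq_tr => i m; rewrite mulrC.
  have -> : tr (fun i m => G k' m * Q i j' l') = Q k' j' l'.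
    by rewrite -[RHS](tr_Gr (fun i => Q i j' l')); apply: eq_tr => i m; rewrite mulrC.
  rewrite (tr_lG (fun m => Q j' k' m)) (Q_skew k' j' l') -/(q k'); ring.
suff q0 r : q r = 0 by rewrite e !q0; ring.
(* The second trace gives [(2 n - 4) q = 0], and [2 n - 4 = 2 d + 6]. *)
apply: (@natr_regular (d + d + 5)%N).
have : tr (fun k l => weyl_divergence r k l) = 0.
  rewrite /weyl_divergence tr_exchange.
  by apply: tr0 => m p; rewrite trZ C_traceless23 mulr0.
rewrite (eq_tr (fun k l => e r k l)) trB trD trZ -/(q r) trZr trG.
rewrite -(trC (fun i m => G r m * q i)) tr_Gl => h.
rewrite -[RHS]oppr0 -h -addn1 !natrD; rewrite n_eqR; ring.
Qed.

(** Let [W] be the left side and [S = a_i Q_jkl + cyc]. The divergence formula gives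
    [W = - (n - 3) S], while [a^m] contracted with [recurrent_bianchi] gives [W = - S] up to terms
    in [a^m Q_jkm], which [n - 3] kills. Hence [(n - 4) W = 0]. *)
Lemma cyclic_recurrence_vector i j k l :
  cyclic_contraction (fun i j => a i * a j) C i j k l = 0.
Proof.
apply: (@natr_regular d).
have e : cyclic_contraction (fun i j => a i * a j) C i j k l =
  a i * weyl_divergence j k l + a j * weyl_divergence k i l
  + a k * weyl_divergence i j l.
  by rewrite -!trZ -!trD; apply: eq_tr => m p; ring.
pose aQ j k := tr (fun m p => a m * Q j k p).
(* Up to sign this is [a^l a^m C_rslm], which vanishes by skewness in the last pair. *)
have aQ0 r s : (n%:R - 3) * aQ r s = 0.
  have : tr (fun m p => a m * weyl_divergence r s p) = 0.
    apply: double_eq0.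
    under eq_tr do rewrite -trZ.
    rewrite {1}tr_exchange -trD; apply: tr0 => m p.
    by rewrite -trD; apply: tr0 => u v; rewrite (curv34 cC r s v p); ring.
  rewrite (eq_tr (fun m p => congr1 (fun x => a m * x) (weyl_divergenceE r s p))).
  move=> h; rewrite -[RHS]oppr0 -h -trZ -trN; apply: eq_tr => m p; ring.
have : cyclic_contraction (fun i j => a i * a j) C i j k l =
  tr (fun m p => a m *
    (a i * C j k l p + a j * C k i l p + a k * C i j l p)).
  by apply: eq_tr => m p; ring.
rewrite (eq_tr (fun m p => congr1 (fun x => a m * x)
  (recurrent_bianchi i j k l p))) => e2.
have e3 : cyclic_contraction (fun i j => a i * a j) C i j k l =
  - (a i * Q j k l + a j * Q k i l + a k * Q i j l)
  + (G i l * aQ j k + G j l * aQ k i + G k l * aQ i j).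
  rewrite e2 -(tr_Gr a i) -(tr_Gr a j) -(tr_Gr a k) -!trZr -!trZ -!trD -trN -trD.
  by apply: eq_tr => m p; ring.
have e4 : (n%:R - 3) * cyclic_contraction (fun i j => a i * a j) C i j k l =
  cyclic_contraction (fun i j => a i * a j) C i j k l.
  rewrite {2}e !weyl_divergenceE e3.
  transitivity (- (n%:R - 3) * (a i * Q j k l + a j * Q k i l + a k * Q i j l)
    + (G i l * ((n%:R - 3) * aQ j k) + G j l * ((n%:R - 3) * aQ k i)
    + G k l * ((n%:R - 3) * aQ i j))); first by ring.
  by rewrite !aQ0; ring.
transitivity ((n%:R - 3) * cyclic_contraction (fun i j => a i * a j) C i j k l
  - cyclic_contraction (fun i j => a i * a j) C i j k l).
  by rewrite n_eqR -addn1 natrD; ring.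
by rewrite e4 subrr.
Qed.

End Divergence.

(** A cyclic contraction with [P] is [X i j k l + X j k i l + X k i j l]; the commutator computation
    is reduced to such values. *)
Let X a b c e := tr (fun m p => P a m * C b c e p).

Let X12 a b c e : X a b c e = - X a c b e.
Proof. by rewrite -trN; apply: eq_tr => m p; rewrite (curv12 cC) mulrN. Qed.

Let X_cyc a b c e : X a b c e + X a c e b + X a e b c = 0.
Proof.
by rewrite -!trD; apply: tr0 => m p; rewrite -!mulrDr (curv_cyc cC) mulr0.
Qed.

Let X_first a b c e : tr (fun s p => P a s * C p b c e) = - X a c e b.
Proof.
by rewrite -trN; apply: eq_tr => s p;
   rewrite (curv_pair cC) (curv34 cC) mulrN.
Qed.

Let ricciE k l :
  tr (fun j m => T j k l m) = - ((n%:R - 2) * P k l + tr P * G k l).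
Proof.
have -> : tr (fun j m => T j k l m) = tr (fun j m => C j k l m - N j k l m).
  by apply: eq_tr => j m; rewrite /C /weyl_part; ring.
by rewrite trB C_traceless tr_kulkarni_nomizu sub0r.
Qed.

(** [V] and [U] are the traced products of [N] with [C] that remain in [cyclic_commutator]: in [V],
    [N] acts on the first slot of [C], in [U] on the third. *)
Let V i j k l :=
  tr (fun m q => tr (fun s p => N i j m s * C p k l q)).
Let U i j k l :=
  tr (fun m q => tr (fun s p => N i m l s * C j k p q)).

Let VE i j k l : V i j k l = X j i k l - X i j k l - X i l j k + X j l i k.
Proof.
have e m q : tr (fun s p => N i j m s * C p k l q) =
   P j m * C i k l q - P i m * C j k l q
   + G j m * tr (fun s p => P i s * C p k l q)
   - G i m * tr (fun s p => P j s * C p k l q).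
  rewrite -(tr_Gl (fun p => C p k l q) i) -(tr_Gl (fun p => C p k l q) j).
  rewrite -!trZ -trB -trD -trB.
  by apply: eq_tr => s p; rewrite /N /kulkarni_nomizu; ring.
rewrite /V (eq_tr e) trB trD trB.
rewrite (tr_Gl (fun q => tr (fun s p => P i s * C p k l q))).
rewrite (tr_Gl (fun q => tr (fun s p => P j s * C p k l q))).
by rewrite !X_first /X; ring.
Qed.

(** Of the four terms of [N], two contract the skew last pair of [C] with a symmetric tensor, the
    inverse metric or [P], and vanish. *)
Let UE i j k l : U i j k l = X l j k i - X i j k l.
Proof.
have skew0 (F : 'I_n -> 'I_n -> A) : (forall m q, F m q = - F q m) -> tr F = 0.
  move=> Fs; apply: double_eq0; rewrite -{1}trC -trD.
  by apply: tr0 => m q; rewrite Fs; ring.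
have e m q : tr (fun s p => N i m l s * C j k p q) =
   P m l * C j k i q - P i l * C j k m q
   + G m l * tr (fun s p => P i s * C j k p q)
   - G i l * tr (fun s p => P m s * C j k p q).
  rewrite -(tr_Gl (fun p => C j k p q) i) -(tr_Gl (fun p => C j k p q) m).
  rewrite -!trZ -trB -trD -trB.
  by apply: eq_tr => s p; rewrite /N /kulkarni_nomizu; ring.
rewrite /U (eq_tr e) trB trD trB !trZ.
have -> : tr (fun m q => C j k m q) = 0 by apply: skew0 => m q; exact: curv34.
have -> : tr (fun m q => tr (fun s p => P m s * C j k p q)) = 0.
  apply: double_eq0; rewrite {1}tr_exchange -trD.
  apply: tr0 => m q; rewrite -trD; apply: tr0 => u v.
  by rewrite (Ps m u) (curv34 cC j k q v); ring.
rewrite (tr_lG (fun q => tr (fun s p => P i s * C j k p q))).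
have -> : tr (fun s p => P i s * C j k p l) = - X i j k l.
  by rewrite -trN; apply: eq_tr => s p; rewrite (curv34 cC) mulrN.
have -> : tr (fun m q => P m l * C j k i q) = X l j k i.
  by apply: eq_tr => m q; rewrite Ps.
ring.
Qed.

(** * The traced Ricci identity of a recurrent Weyl tensor *)

Section RicciIdentity.
Variable F : 'I_n -> 'I_n -> A.
Hypothesis ricci_identity : forall i j k l m q,
  F i j * C k l m q =
    tr (fun s p => T i j k s * C p l m q)
  + tr (fun s p => T i j l s * C k p m q)
  + tr (fun s p => T i j m s * C k l p q)
  + tr (fun s p => T i j q s * C k l m p).

(** Contract the Ricci identity over [j] and [q] and sum cyclically. The action on the last slot
    produces the Ricci tensor and contributes [- (n - 2)]; the other three slots contribute [+ 2]
    through [V] and [U]. *)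
Lemma cyclic_commutator i j k l : cyclic_contraction F C i j k l =
  - (n%:R - 4) * cyclic_contraction P C i j k l.
Proof.
pose t2 (K : 'I_n -> 'I_n -> 'I_n -> 'I_n -> A) :=
  tr (fun m q => tr (fun s p => K m q s p)).
have t2D K L : t2 (fun m q s p => K m q s p + L m q s p) = t2 K + t2 L.
  by rewrite -trD; apply: eq_tr => m q; rewrite trD.
have eq_t2 K L : (forall m q s p, K m q s p = L m q s p) -> t2 K = t2 L.
  by move=> e; apply: eq_tr => m q; apply: eq_tr => s p; exact: e.
have t2N K : t2 (fun m q s p => - K m q s p) = - t2 K.
  by rewrite -trN; apply: eq_tr => m q; rewrite trN.
have ric a b c e : t2 (fun m q s p => T a m q s * C b c e p) =
    - (n%:R - 2) * X a b c e - tr P * C b c e a.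
  rewrite /t2 tr_exchange.
  transitivity (tr (fun s p =>
      - (n%:R - 2) * (P a s * C b c e p) - tr P * (G a s * C b c e p))).
    apply: eq_tr => s p; rewrite trZr.
    rewrite (_ : tr (fun m q => T a m q s) = tr (fun m q => T m a s q)).
      by rewrite ricciE (Gsym a s); ring.
    by apply: eq_tr => m q; rewrite (curv12 cT) (curv34 cT) opprK.
  by rewrite trB !trZ tr_Gl.
have con a b c e : tr (fun m q => F a m * C b c e q) =
    t2 (fun m q s p => T a m b s * C p c e q)
    + t2 (fun m q s p => T a m c s * C b p e q)
    + t2 (fun m q s p => T a m e s * C b c p q)
    + (- (n%:R - 2) * X a b c e - tr P * C b c e a).
  by rewrite -ric -!t2D; apply: eq_tr => m q; rewrite ricci_identity !trD.
(* The part quadratic in [C] cancels, so only [N] survives in [T = C - N]. *)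
have cancel a b c e : t2 (fun m q s p => T a m b s * C p c e q)
    + t2 (fun m q s p => T b m a s * C c p e q)
    + t2 (fun m q s p => T c m e s * C a b p q) =
    - (V a b c e + U c a b e).
  (* After renaming contracted indices the two products differ only by a swap in the first pair of
     one factor, so they are opposite. *)
  have CC : t2 (fun m q s p => C a b m s * C p c e q)
      + t2 (fun m q s p => C c m e s * C a b p q) = 0.
    rewrite {1}/t2 tr_exchange.
    rewrite (_ : tr _ = t2 (fun m q s p => C a b p q * C m c e s)); last first.
      rewrite -trC; apply: eq_tr => m q; rewrite -trC.
      by apply: eq_tr => s p.
    rewrite -t2D; apply: tr0 => m q; apply: tr0 => s p.
    by rewrite (curv12 cC m c); ring.
  have -> : V a b c e + U c a b e = t2 (fun m q s p =>
      N a b m s * C p c e q + N c m e s * C a b p q) by rewrite t2D.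
  rewrite -[RHS]addr0 -CC -t2N -!t2D; apply: eq_t2 => m q s p.
  (* The first Bianchi identity trades [T a m b s - T b m a s] for [T a b m s]. *)
  have := curv_cyc cT a m b s.
  rewrite (curv12 cC c p) (curv12 cT m b) (curv12 cT b a) => h.
  transitivity ((T a m b s - T b m a s - T a b m s) * C p c e q
    + T a b m s * C p c e q + T c m e s * C a b p q); first by ring.
  by rewrite h /C /weyl_part; ring.
rewrite /cyclic_contraction !trD !con.
rewrite -[RHS]/(- (n%:R - 4) * (X i j k l + X j k i l + X k i j l)).
(* Each use of [cancel] groups the first slot of one permutation with the second and third slots of
   the other two. *)
transitivity (- (V i j k l + U k i j l) - (V j k i l + U i j k l)
    - (V k i j l + U j k i l)
    - (n%:R - 2) * (X i j k l + X j k i l + X k i j l)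
    - tr P * (C j k l i + C k i l j + C i j l k)).
  by rewrite -!cancel; ring.
rewrite (curv34 cC j k l i) (curv34 cC k i l j) (curv34 cC i j l k) -!opprD.
rewrite (curv_cyc cC) !VE !UE.
have Xe a b c e : X a e b c = - X a b c e - X a c e b.
  by apply/eqP; rewrite -subr_eq0 -[0](X_cyc a b c e); apply/eqP; ring.
rewrite (Xe i j k l) (X12 i k j l) (X12 i l k j).
rewrite (Xe j k i l) (X12 j i k l) (X12 j l i k).
rewrite (Xe k i j l) (X12 k j i l) (X12 k l j i).
rewrite (Xe l i j k); ring.
Qed.

End RicciIdentity.
End Weyl.

(** For goals that follow linearly from a known equation: what is left is an identity for [ring]. *)
Lemma subr_eq_trans (V : zmodType) (x y u v : V) : x = y -> u - v = x - y -> u = v.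
Proof. by move=> -> /eqP; rewrite subrr subr_eq0 => /eqP. Qed.

(** * Covariant derivatives over a ring with commuting derivations *)

Section Derivations.
(** The derivations model the partial derivatives in a chart; [DC] is the symmetry of second
    derivatives. *)
Variable D : 'I_n -> A -> A.
Hypothesis DD : forall i x y, D i (x + y) = D i x + D i y.
Hypothesis DM : forall i x y, D i (x * y) = D i x * y + x * D i y.
Hypothesis DC : forall i j x, D i (D j x) = D j (D i x).

Let D0 i : D i 0 = 0.
Proof. by apply: (addIr (D i 0)); rewrite -DD !add0r. Qed.

Let DN i x : D i (- x) = - D i x.
Proof. by apply: (addrI (D i x)); rewrite -DD !subrr D0. Qed.

Let DB i x y : D i (x - y) = D i x - D i y.
Proof. by rewrite DD DN. Qed.

Let D1 i : D i 1 = 0.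
Proof. by apply: (addIr (D i 1)); rewrite add0r -[in RHS](mulr1 1) DM mulr1 mul1r. Qed.

Let Dn i k : D i k%:R = 0.
Proof. by elim: k => [|k e]; rewrite ?D0 // mulrS DD D1 e add0r. Qed.

Let Dsum i m (F : 'I_m -> A) : D i (\sum_p F p) = \sum_p D i (F p).
Proof. exact: (big_morph (D i) (DD i) (D0 i)). Qed.

(** [half] serves as the inverse of 2, since [A] carries no inverse operation. *)
Variable half : A.
Hypothesis half2 : half * 2 = 1.

(** * Christoffel symbols and covariant derivatives *)

Definition connection m i j : A :=
  half * \sum_p H m p * (D i (G j p) + D j (G i p) - D p (G i j)).

(** Hiding the sum over the upper Christoffel index behind an operator lets [ring] treat such sums
    as atoms. *)
Definition conn_act i j (F : 'I_n -> A) : A := \sum_q connection q i j * F q.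
Local Notation ga := conn_act.

Lemma connectionC m i j : connection m i j = connection m j i.
Proof.
by congr (_ * _); apply: eq_bigr => p _; rewrite (Gsym i j) [D i _ + _]addrC.
Qed.

Lemma eq_conn_act i j F K : (forall q, F q = K q) -> ga i j F = ga i j K.
Proof. by move=> e; apply: eq_bigr => q _; rewrite e. Qed.

Lemma conn_actC i j F : ga i j F = ga j i F.
Proof. by apply: eq_bigr => q _; rewrite connectionC. Qed.

Lemma conn_actD i j F K : ga i j (fun q => F q + K q) = ga i j F + ga i j K.
Proof. by rewrite -big_split; apply: eq_bigr => q _; rewrite mulrDr. Qed.

Lemma conn_actZ i j c F : ga i j (fun q => c * F q) = c * ga i j F.
Proof. by rewrite mulr_sumr; apply: eq_bigr => q _; rewrite mulrCA. Qed.

Lemma conn_actZr i j c F : ga i j (fun q => F q * c) = ga i j F * c.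
Proof. by rewrite mulrC -conn_actZ; apply: eq_conn_act => q; rewrite mulrC. Qed.

Lemma conn_actN i j F : ga i j (fun q => - F q) = - ga i j F.
Proof. by rewrite -mulN1r -conn_actZ; apply: eq_conn_act => q; rewrite mulN1r. Qed.

Lemma conn_actB i j F K : ga i j (fun q => F q - K q) = ga i j F - ga i j K.
Proof. by rewrite conn_actD conn_actN. Qed.

Lemma conn_act0 i j F : (forall q, F q = 0) -> ga i j F = 0.
Proof. by move=> F0; apply: big1 => q _; rewrite F0 mulr0. Qed.

Lemma conn_act_sum i j (F : 'I_n -> 'I_n -> A) (K : 'I_n -> A) :
  ga i j (fun q => \sum_r F q r * K r) = \sum_r ga i j (fun q => F q r) * K r.
Proof.
rewrite /ga; under eq_bigr do rewrite mulr_sumr.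
rewrite exchange_big; apply: eq_bigr => r _; rewrite mulr_suml.
by apply: eq_bigr => q _; rewrite mulrA.
Qed.

Lemma conn_act_exchange i j k l F :
  ga i j (fun q => ga k l (F q)) = ga k l (fun r => ga i j (fun q => F q r)).
Proof.
rewrite /ga; under eq_bigr do rewrite mulr_sumr.
rewrite exchange_big; apply: eq_bigr => r _; rewrite mulr_sumr.
by apply: eq_bigr => q _; rewrite mulrCA.
Qed.

Lemma conn_act_tr i j (F : 'I_n -> 'I_n -> 'I_n -> A) :
  ga i j (fun q => tr (F q)) = tr (fun m p => ga i j (fun q => F q m p)).
Proof. by rewrite -sum_tr; apply: eq_bigr => q _; rewrite trZ. Qed.

Definition dconn_act i j k (F : 'I_n -> A) : A := \sum_q D i (connection q j k) * F q.
Local Notation dg := dconn_act.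

Lemma derivation_conn_act i j k F :
  D i (ga j k F) = dg i j k F + ga j k (fun q => D i (F q)).
Proof. by rewrite Dsum -big_split; apply: eq_bigr => q _; rewrite DM. Qed.

Definition cov1 (v : 'I_n -> A) i j : A := D i (v j) - ga i j v.
Definition cov2 (S : 'I_n -> 'I_n -> A) i j k : A :=
  D i (S j k) - ga i j (fun m => S m k) - ga i k (fun m => S j m).
Definition cov3 (S : 'I_n -> 'I_n -> 'I_n -> A) i j k l : A :=
  D i (S j k l) - ga i j (fun m => S m k l) - ga i k (fun m => S j m l)
  - ga i l (fun m => S j k m).
Definition cov4 (S : 'I_n -> 'I_n -> 'I_n -> 'I_n -> A) i j k l m : A :=
  D i (S j k l m) - ga i j (fun p => S p k l m) - ga i k (fun p => S j p l m)
  - ga i l (fun p => S j k p m) - ga i m (fun p => S j k l p).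

(** * Curvature and the Ricci identities *)

Definition coord_covec (m l : 'I_n) : A := (l == m)%:R.

Definition curvature (j k l m : 'I_n) : A :=
  cov2 (cov1 (coord_covec m)) j k l
  - cov2 (cov1 (coord_covec m)) k j l.

(** The covariant derivative of [dx^p] is [- Gamma^p], so the defining commutator unfolds to the
    classical formula. *)
Lemma curvatureE i j k p : curvature i j k p =
  D j (connection p i k) - D i (connection p j k)
  + ga i k (fun q => connection p j q) - ga j k (fun q => connection p i q).
Proof.
have e q r : cov1 (coord_covec p) q r = - connection p q r.
  rewrite /cov1 Dn add0r; congr (- _).
  rewrite -[RHS](sum_delta (fun m => connection m q r)).
  by apply: eq_bigr => m _; rewrite mulrC eq_sym.
rewrite /curvature /cov2 !e !DN.
rewrite !(eq_conn_act _ _ (fun m => e _ m)) !(eq_conn_act _ _ (fun m => e m _)).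
rewrite !conn_actN (conn_actC j i); ring.
Qed.

Definition curv_act i j k (F : 'I_n -> A) : A := \sum_p curvature i j k p * F p.
Local Notation rs := curv_act.

Lemma curv_actE i j k F : rs i j k F =
  dg j i k F - dg i j k F + ga i k (fun q => ga j q F)
  - ga j k (fun q => ga i q F).
Proof.
have e a b : ga a k (fun q => ga b q F) =
    \sum_p ga a k (fun q => connection p b q) * F p.
  rewrite /ga; under eq_bigr do rewrite mulr_sumr.
  rewrite exchange_big; apply: eq_bigr => r _; rewrite mulr_suml.
  by apply: eq_bigr => q _; rewrite mulrA.
rewrite !e -!sumrB -big_split -sumrB; apply: eq_bigr => p _.
by rewrite curvatureE /=; ring.
Qed.

(** Second derivatives cancel by [DC], corrections of the derivative index by the symmetry of the
    connection, and Christoffel products on different slots by exchanging sums. *)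
Lemma ricci_identity2 S i j k l :
  cov3 (cov2 S) i j k l - cov3 (cov2 S) j i k l =
  rs i j k (fun m => S m l) + rs i j l (fun m => S k m).
Proof.
rewrite /cov3 /cov2 !DB !derivation_conn_act !conn_actB !curv_actE DC.
rewrite !(conn_actC j i) (conn_act_exchange i k j l) (conn_act_exchange i l j k).
by ring.
Qed.

(* Applying [cov4 S i = a i * S] twice, the terms in [a] drop out of the
   commutator except for the curl of [a]. *)
Lemma ricci_identity_recurrent a S :
  (forall i j k l m, cov4 S i j k l m = a i * S j k l m) ->
  forall i j k l m q,
  (cov1 a i j - cov1 a j i) * S k l m q =
    rs i j k (fun p => S p l m q) + rs i j l (fun p => S k p m q)
  + rs i j m (fun p => S k l p q) + rs i j q (fun p => S k l m p).
Proof.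
move=> rec i j k l m q.
have e b k' l' m' q' : D b (S k' l' m' q') = a b * S k' l' m' q'
    + ga b k' (fun p => S p l' m' q') + ga b l' (fun p => S k' p m' q')
    + ga b m' (fun p => S k' l' p q') + ga b q' (fun p => S k' l' m' p).
  by rewrite -rec /cov4; ring.
have dd b c : D b (D c (S k l m q)) = D b (a c) * S k l m q
    + a c * D b (S k l m q)
    + (dg b c k (fun p => S p l m q) + dg b c l (fun p => S k p m q)
      + dg b c m (fun p => S k l p q) + dg b c q (fun p => S k l m p))
    + (ga c k (fun p => D b (S p l m q)) + ga c l (fun p => D b (S k p m q))
      + ga c m (fun p => D b (S k l p q)) + ga c q (fun p => D b (S k l m p))).
  by rewrite (e c) !DD DM !derivation_conn_act; ring.
(* Nested terms on one slot yield the curvature; each of the six mixed groups is symmetric in [b]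
   and [c] and leaves the commutator. *)
have ee b c : ga c k (fun p => D b (S p l m q)) + ga c l (fun p => D b (S k p m q))
      + ga c m (fun p => D b (S k l p q)) + ga c q (fun p => D b (S k l m p))
    = a b * (D c (S k l m q) - a c * S k l m q)
    + (ga c k (fun p => ga b p (fun r => S r l m q))
      + ga c l (fun p => ga b p (fun r => S k r m q))
      + ga c m (fun p => ga b p (fun r => S k l r q))
      + ga c q (fun p => ga b p (fun r => S k l m r)))
    + (ga c k (fun p => ga b l (fun r => S p r m q))
      + ga b k (fun p => ga c l (fun r => S p r m q)))
    + (ga c k (fun p => ga b m (fun r => S p l r q))
      + ga b k (fun p => ga c m (fun r => S p l r q)))
    + (ga c k (fun p => ga b q (fun r => S p l m r))
      + ga b k (fun p => ga c q (fun r => S p l m r)))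
    + (ga c l (fun p => ga b m (fun r => S k p r q))
      + ga b l (fun p => ga c m (fun r => S k p r q)))
    + (ga c l (fun p => ga b q (fun r => S k p m r))
      + ga b l (fun p => ga c q (fun r => S k p m r)))
    + (ga c m (fun p => ga b q (fun r => S k l p r))
      + ga b m (fun p => ga c q (fun r => S k l p r))).
  rewrite (eq_conn_act _ _ (fun p => e b p l m q)).
  rewrite (eq_conn_act _ _ (fun p => e b k p m q)).
  rewrite (eq_conn_act _ _ (fun p => e b k l p q)).
  rewrite (eq_conn_act _ _ (fun p => e b k l m p)).
  rewrite !conn_actD !conn_actZ.
  rewrite (conn_act_exchange c l b k) (conn_act_exchange c m b k).
  rewrite (conn_act_exchange c m b l) (conn_act_exchange c q b k).
  rewrite (conn_act_exchange c q b l) (conn_act_exchange c q b m).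
  by rewrite (e c); ring.
have := DC i j (S k l m q).
rewrite !dd !ee !curv_actE /cov1 (conn_actC j i) => h.
by apply: (subr_eq_trans h); ring.
Qed.

(** * The metric and its inverse are parallel *)

Lemma cov2_metric i j k : cov2 G i j k = 0.
Proof.
(* Lowering the upper index yields Christoffel symbols of the first kind; the two that occur add up
   to [D i (G j k)]. *)
have e r s : ga i r (fun m => G m s) =
    half * (D i (G r s) + D r (G i s) - D s (G i r)).
  rewrite /ga /connection; under eq_bigr do rewrite -mulrA mulr_suml.
  rewrite -mulr_sumr exchange_big; congr (half * _).
  rewrite -[RHS](sum_delta (fun p => D i (G r p) + D r (G i p) - D p (G i r))).
  apply: eq_bigr => p _; rewrite eq_sym -HG mulr_suml; apply: eq_bigr => m _.
  by rewrite (Hsym p m); ring.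
rewrite /cov2 e (eq_conn_act _ _ (fun m => Gsym j m)) e.
rewrite (Gsym k j) -[X in X - _ - _]mul1r -half2.
by ring.
Qed.

Lemma derivation_metric i j k :
  D i (G j k) = ga i j (fun m => G m k) + ga i k (fun m => G j m).
Proof. by apply/subr0_eq; rewrite -[RHS](cov2_metric i j k) /cov2; ring. Qed.

(** [L] is the covariant derivative of the inverse metric. Differentiating [H G = 1] gives
    [L G = 0], and multiplying by [H] gives [L = 0]. *)
Lemma derivation_inverse_metric k i m :
  D k (H i m) = - \sum_q (connection i k q * H q m + connection m k q * H i q).
Proof.
pose L m := D k (H i m)
  + \sum_q (connection i k q * H q m + connection m k q * H i q).
suff L0 r : \sum_m L m * G m r = 0.
  apply/eqP; rewrite -addr_eq0 -/(L m); apply/eqP.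
  transitivity (\sum_r (\sum_m L m * G m r) * H r m).
    under eq_bigr do rewrite mulr_suml.
    rewrite exchange_big /= -[LHS](sum_delta L); apply: eq_bigr => s _.
    rewrite -HG mulr_suml; apply: eq_bigr => r _.
    by rewrite (Hsym m r) (Gsym r s); ring.
  by apply: big1 => r _; rewrite L0 mul0r.
have e1 : \sum_m D k (H i m) * G m r = - \sum_m H i m * D k (G m r).
  apply/eqP; rewrite -addr_eq0 -big_split /=; apply/eqP.
  rewrite -[RHS](Dn k (i == r)) -HG Dsum.
  by apply: eq_bigr => s _; rewrite DM.
have e2 F : \sum_s H i s * \sum_q F q * G s q = F i.
  under eq_bigr do rewrite mulr_sumr.
  rewrite exchange_big /= -[RHS](sum_delta F); apply: eq_bigr => q _.
  by rewrite -HG mulr_suml; apply: eq_bigr => s _; rewrite (Gsym s q); ring.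
have e3 F : \sum_s (\sum_q F q * H q s) * G s r = F r.
  under eq_bigr do rewrite mulr_suml.
  rewrite exchange_big /= -[RHS](sum_delta F); apply: eq_bigr => q _.
  by rewrite eq_sym -HG mulr_suml; apply: eq_bigr => s _; ring.
have e4 : \sum_s H i s * D k (G s r) =
    \sum_s H i s * ga k s (fun q => G q r) + connection i k r.
  rewrite -[connection i k r](e2 (fun q => connection q k r)) -big_split.
  by apply: eq_bigr => s _; rewrite derivation_metric mulrDr.
have e5 : \sum_s (\sum_q connection s k q * H i q) * G s r =
    \sum_s H i s * ga k s (fun q => G q r).
  under eq_bigr do rewrite mulr_suml.
  rewrite exchange_big; apply: eq_bigr => q _; rewrite mulr_sumr.
  by apply: eq_bigr => s _; ring.
transitivity (\sum_s (D k (H i s) * G s r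
    + (\sum_q connection i k q * H q s) * G s r
    + (\sum_q connection s k q * H i q) * G s r)).
  by apply: eq_bigr => s _; rewrite /L big_split /=; ring.
by rewrite !big_split /= e1 e3 e4 e5; ring.
Qed.

(** The inverse metric is parallel: its derivative supplies exactly the Christoffel terms of [cov2],
    after renaming summation indices. *)
Lemma derivation_tr k F : D k (tr F) = tr (fun i m => cov2 F k i m).
Proof.
rewrite /cov2 !trB -addrA -opprD.
transitivity (\sum_i \sum_m (H i m * D k (F i m) - \sum_q
   (connection i k q * H q m * F i m + connection m k q * H i q * F i m))).
  rewrite Dsum; apply: eq_bigr => i _; rewrite Dsum; apply: eq_bigr => m _.
  rewrite DM derivation_inverse_metric mulNr mulr_suml addrC; congr (_ - _).
  by apply: eq_bigr => q _; ring.
under eq_bigr do rewrite sumrB.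
rewrite sumrB; congr (_ - _).
under eq_bigr do under eq_bigr do rewrite big_split.
under eq_bigr do rewrite big_split.
rewrite big_split /=; congr (_ + _).
  under eq_bigr do rewrite exchange_big.
  rewrite exchange_big; apply: eq_bigr => q _; rewrite exchange_big.
  apply: eq_bigr => m _; rewrite mulr_sumr; apply: eq_bigr => i _; ring.
apply: eq_bigr => i _; rewrite exchange_big; apply: eq_bigr => q _.
rewrite mulr_sumr; apply: eq_bigr => m _; ring.
Qed.

Lemma eq_cov3 S S' i j k l : (forall j k l, S j k l = S' j k l) ->
  cov3 S i j k l = cov3 S' i j k l.
Proof.
by move=> e; rewrite /cov3 e; do !congr (_ - _); apply: eq_conn_act => q.
Qed.

Lemma eq_cov4 S S' i j k l m : (forall j k l m, S j k l m = S' j k l m) ->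
  cov4 S i j k l m = cov4 S' i j k l m.
Proof.
by move=> e; rewrite /cov4 e; do !congr (_ - _); apply: eq_conn_act => q.
Qed.

Lemma cov4_kulkarni_nomizu P i j k l m :
  cov4 (kulkarni_nomizu P) i j k l m =
  G j m * cov2 P i k l - G k m * cov2 P i j l
  + cov2 P i j m * G k l - cov2 P i k m * G j l.
Proof.
rewrite /cov4 /kulkarni_nomizu !(DB, DD) !DM !derivation_metric.
rewrite !(conn_actB, conn_actD) !(conn_actZ, conn_actZr) /cov2; ring.
Qed.

Lemma cov3_weyl_divergence a C i j k l :
  cov3 (fun j k l => tr (fun m p => a m * C j k l p)) i j k l =
  tr (fun m p => cov1 a i m * C j k l p + a m * cov4 C i j k l p).
Proof.
rewrite /cov3 derivation_tr !conn_act_tr -!trB; apply: eq_tr => m p.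
rewrite /cov2 /cov1 /cov4 DM !conn_actZ conn_actZr; ring.
Qed.

(** * Symmetries of the curvature and the Bianchi identities *)

Definition riemann_low i j k l : A := \sum_p curvature i j k p * G p l.

Lemma curv_act_tr i j k F :
  rs i j k F = tr (fun s p => riemann_low i j k s * F p).
Proof.
under eq_tr do rewrite mulr_suml.
rewrite -sum_tr; apply: eq_bigr => q _.
under eq_tr do rewrite -mulrA.
by rewrite trZ tr_Gl.
Qed.

Lemma curvature_skew i j k l : curvature i j k l = - curvature j i k l.
Proof. by rewrite /curvature; ring. Qed.

Lemma curvature_cyc i j k l :
  curvature i j k l + curvature j k i l + curvature k i j l = 0.
Proof.
rewrite !curvatureE (conn_actC k i) (conn_actC j i) (conn_actC k j).
rewrite (connectionC l k i) (connectionC l j i) (connectionC l k j); ring.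
Qed.

(** Skewness in the last pair is the Ricci identity applied to the parallel tensor [G]. *)
Lemma curvature_like_riemann_low : curvature_like riemann_low.
Proof.
split=> j k l m.
- rewrite -sumrN; apply: eq_bigr => p _; rewrite curvature_skew; ring.
- apply/eqP; rewrite -addr_eq0; apply/eqP.
  have := ricci_identity2 G j k l m.
  have c0 a b c d : cov3 (cov2 G) a b c d = 0.
    rewrite /cov3 cov2_metric D0 !conn_act0 ?subr0 // => p; exact: cov2_metric.
  rewrite !c0 subr0 => ->; congr (_ + _).
  by apply: eq_bigr => p _; rewrite (Gsym l p).
- rewrite -!big_split big1 // => p _ /=.
  by rewrite -!mulrDl curvature_cyc mul0r.
Qed.

(** As [G] is parallel, the last index may be raised: [B] is the covariant derivative of the mixed
    curvature. Its cyclic sum vanishes by [DC] and the symmetry of the connection. *)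
Lemma second_bianchi i j k l m :
  cov4 riemann_low i j k l m + cov4 riemann_low j k i l m
  + cov4 riemann_low k i j l m = 0.
Proof.
pose B i j k l r := D i (curvature j k l r)
  - ga i j (fun q => curvature q k l r) - ga i k (fun q => curvature j q l r)
  - ga i l (fun q => curvature j k q r)
  + rs j k l (fun p => connection r i p).
have e a b c : cov4 riemann_low a b c l m = \sum_r B a b c l r * G r m.
  rewrite /cov4 !conn_act_sum Dsum.
  have -> : ga a m (fun q => riemann_low b c l q) =
      \sum_r curvature b c l r * ga a m (fun q => G r q).
    rewrite -[LHS](eq_conn_act _ _ (fun q => eq_bigr _ (fun r _ => mulrC _ _))).
    by rewrite conn_act_sum; apply: eq_bigr => r _; rewrite mulrC.
  have rsE : \sum_r rs b c l (fun p => connection r a p) * G r m =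
      \sum_r curvature b c l r * ga a r (fun q => G q m).
    rewrite /curv_act; under eq_bigr do rewrite mulr_suml.
    rewrite exchange_big; apply: eq_bigr => p _; rewrite mulr_sumr.
    by apply: eq_bigr => r _; rewrite mulrA.
  rewrite /B; under [RHS]eq_bigr do rewrite mulrDl !mulrBl.
  rewrite big_split rsE !sumrB /=.
  have -> : \sum_p D a (curvature b c l p * G p m) =
      \sum_p D a (curvature b c l p) * G p m
      + \sum_p curvature b c l p * ga a p (fun q => G q m)
      + \sum_p curvature b c l p * ga a m (fun q => G p q).
    rewrite -!big_split; apply: eq_bigr => p _.
    by rewrite DM derivation_metric mulrDr addrA.
  ring.
rewrite !e -!big_split big1 // => r _ /=; rewrite -!mulrDl.
rewrite [X in X * _](_ : _ = 0) ?mul0r // /B.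
rewrite (conn_actC k i) (conn_actC j i) (conn_actC k j).
rewrite (eq_conn_act _ _ (fun q => curvature_skew i q l r)) conn_actN.
rewrite (eq_conn_act _ _ (fun q => curvature_skew j q l r)) conn_actN.
rewrite (eq_conn_act _ _ (fun q => curvature_skew k q l r)) conn_actN.
have cE a b c : ga a l (fun q => curvature b c q r) =
    ga a l (fun q => D c (connection r b q)) - ga a l (fun q => D b (connection r c q))
    + ga a l (fun q => ga b q (fun s => connection r c s))
    - ga a l (fun q => ga c q (fun s => connection r b s)).
  rewrite (eq_conn_act _ _ (fun q => curvatureE b c q r)).
  by rewrite conn_actB conn_actD conn_actB.
rewrite !cE !curv_actE !curvatureE !(DD, DN) !derivation_conn_act.
rewrite (DC j i) (DC k i) (DC k j); ring.
Qed.

(** * The compatibility identities for a conformally recurrent metric *)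

Section ConformallyRecurrent.
(** [c1] and [c2] stand for the inverses of [n - 1] and [n - 2]. *)
Variables (d : nat) (c1 c2 : A).
Hypothesis n_eq : n = d.+1.+4.
Hypothesis c1E : c1 * (n%:R - 1) = 1.
Hypothesis c2E : c2 * (n%:R - 2) = 1.

Definition ricci_tens k l : A := - \sum_m curvature m k l m.
Definition ricci_mixed j m : A := \sum_p ricci_tens j p * H p m.
Definition scalar_curv : A := tr ricci_tens.
Definition weyl_mixed j k l m : A :=
  curvature j k l m
  + c2 * ((j == m)%:R * ricci_tens k l - (k == m)%:R * ricci_tens j l
    + ricci_mixed j m * G k l - ricci_mixed k m * G j l)
  - scalar_curv * (((j == m)%:R * G k l - (k == m)%:R * G j l) * (c1 * c2)).
Definition weyl_lower j k l m : A := \sum_p weyl_mixed j k l p * G p m.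
Definition schouten k l : A :=
  c2 * (ricci_tens k l - half * c1 * scalar_curv * G k l).

Lemma ricci_tensE k l : ricci_tens k l = - tr (fun j m => riemann_low j k l m).
Proof.
congr (- _); apply: eq_bigr => j _.
under [RHS]eq_bigr do rewrite mulr_sumr.
rewrite exchange_big /= -[LHS](sum_delta (curvature j k l)).
apply: eq_bigr => p _; rewrite -HG mulr_suml; apply: eq_bigr => m _.
by rewrite (Gsym p m); ring.
Qed.

Lemma ricci_tensC k l : ricci_tens k l = ricci_tens l k.
Proof.
rewrite !ricci_tensE -[in RHS]trC; congr (- _); apply: eq_tr => j m.
have cT := curvature_like_riemann_low.
by rewrite (curv_pair cT) (curv12 cT) (curv34 cT) opprK.
Qed.

Lemma schoutenC k l : schouten k l = schouten l k.
Proof. by rewrite /schouten ricci_tensC Gsym. Qed.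

Lemma ricci_schouten k l :
  ricci_tens k l = (n%:R - 2) * schouten k l + half * c1 * scalar_curv * G k l.
Proof. by rewrite /schouten mulrA [_ * c2]mulrC c2E; ring. Qed.

Lemma tr_schouten : tr schouten = half * c1 * scalar_curv.
Proof.
rewrite /schouten trZ trB trZ trG -/scalar_curv.
transitivity (c2 * (scalar_curv * (half * 2 * (c1 * (n%:R - 1)))
   - half * c1 * scalar_curv * n%:R)); first by rewrite half2 c1E !mulr1.
transitivity (half * c1 * scalar_curv * (c2 * (n%:R - 2))); first by ring.
by rewrite c2E mulr1.
Qed.

Local Notation C := (weyl_part riemann_low schouten).

Lemma weyl_lowerE j k l m : weyl_lower j k l m = C j k l m.
Proof.
have e q : \sum_p ricci_mixed q p * G p m = ricci_tens q m.
  rewrite /ricci_mixed; under eq_bigr do rewrite mulr_suml.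
  rewrite exchange_big /= -[RHS](sum_delta (ricci_tens q)).
  by apply: eq_bigr => p _; rewrite eq_sym -HG mulr_suml; apply: eq_bigr => s _; ring.
transitivity (riemann_low j k l m
    + c2 * (G j m * ricci_tens k l - G k m * ricci_tens j l
      + ricci_tens j m * G k l - ricci_tens k m * G j l)
    - scalar_curv * ((G j m * G k l - G k m * G j l) * (c1 * c2))).
  rewrite /weyl_lower /weyl_mixed -!e; move: scalar_curv => s.
  rewrite -(sum_delta (fun p => G p m) j) -(sum_delta (fun p => G p m) k).
  rewrite !mulr_suml -!(sumrB, big_split) /= !mulr_suml !mulr_sumr.
  rewrite -!(sumrB, big_split) /=; apply: eq_bigr => p _.
  ring.
rewrite /weyl_part /kulkarni_nomizu /schouten.
(* The scalar part of [schouten] enters the Kulkarni-Nomizu product twice, which compensates its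
   factor [half]. *)
rewrite -[scalar_curv * _]mul1r -half2; ring.
Qed.

Lemma weyl_mixedE j k l m :
  weyl_mixed j k l m = \sum_p weyl_lower j k l p * H p m.
Proof.
under eq_bigr do rewrite mulr_suml.
rewrite exchange_big /= -[LHS](sum_delta (weyl_mixed j k l)).
apply: eq_bigr => q _; rewrite -HG mulr_suml; apply: eq_bigr => p _.
by rewrite (Gsym p q) (Hsym m p); ring.
Qed.

Lemma weyl_traceless k l : tr (fun j m => C j k l m) = 0.
Proof.
rewrite /weyl_part trD tr_kulkarni_nomizu tr_schouten -ricci_schouten.
by rewrite ricci_tensE addrN.
Qed.

Lemma weyl_compatE (b : 'I_n -> 'I_n -> A) i j k l :
  \sum_m (b i m * weyl_mixed j k l m + b j m * weyl_mixed k i l m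
          + b k m * weyl_mixed i j l m) = cyclic_contraction b C i j k l.
Proof.
apply: eq_bigr => m _; rewrite !weyl_mixedE !mulr_sumr -!big_split /=.
by apply: eq_bigr => p _; rewrite !weyl_lowerE (Hsym m p); ring.
Qed.

Lemma riemann_compatE (b : 'I_n -> 'I_n -> A) i j k l :
  \sum_m (b i m * curvature j k l m + b j m * curvature k i l m
          + b k m * curvature i j l m)
  = cyclic_contraction b riemann_low i j k l.
Proof.
rewrite /cyclic_contraction !trD !big_split /=.
have e q r s : \sum_m b q m * curvature r s l m =
    tr (fun m p => b q m * riemann_low r s l p).
  transitivity (rs r s l (b q)).
    by apply: eq_bigr => m _; rewrite mulrC.
  by rewrite curv_act_tr -trC; apply: eq_tr => m p; rewrite mulrC.
by rewrite !e.
Qed.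

Variable a : 'I_n -> A.
Hypothesis recurrent : forall i j k l m,
  cov4 weyl_lower i j k l m = a i * weyl_lower j k l m.

Let cT := curvature_like_riemann_low.
Let Ps := schoutenC.
Let cC : curvature_like C. Proof. exact: curvature_like_weyl_part. Qed.

Let recC i j k l m : cov4 C i j k l m = a i * C j k l m.
Proof. by rewrite -weyl_lowerE -recurrent; apply: eq_cov4 => *; rewrite weyl_lowerE. Qed.

Let Q j k l := cov2 schouten j k l - cov2 schouten k j l.

(** The Riemann part leaves the cyclic sum by [second_bianchi]; in the Kulkarni-Nomizu part the
    derivatives of [schouten] pair up into curls. *)
Let recurrent_bianchi i j k l m :
  a i * C j k l m + a j * C k i l m + a k * C i j l m =
  - (G i m * Q j k l + G j m * Q k i l + G k m * Q i j l)
  + (G i l * Q j k m + G j l * Q k i m + G k l * Q i j m).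
Proof.
have e b c f : a b * C c f l m = cov4 riemann_low b c f l m
    + cov4 (kulkarni_nomizu schouten) b c f l m.
  by rewrite -recC /cov4 /weyl_part DD !conn_actD; ring.
rewrite !e !cov4_kulkarni_nomizu /Q -[RHS]addr0 -(second_bianchi i j k l m).
ring.
Qed.

Let X := cyclic_contraction schouten C.

(** Differentiate the divergence formula and sum cyclically: the terms [a_i a_m C_jkl^m] vanish by
    [cyclic_recurrence_vector], and the cyclic sum of [cov3 Q] is a sum of commutators of
    derivatives of [schouten]. *)
Lemma cyclic_cov_recurrence_vector i j k l :
  cyclic_contraction (cov1 a) C i j k l = - (n%:R - 3) * X i j k l.
Proof.
have Q_skew j' k' l' : Q j' k' l' = - Q k' j' l' by rewrite /Q; ring.
have divE j' k' l' : tr (fun m p => a m * C j' k' l' p) = - (n%:R - 3) * Q j' k' l'.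
  exact: (weyl_divergenceE cT Ps weyl_traceless n_eq Q_skew recurrent_bianchi).
have e b c f : tr (fun m p => cov1 a b m * C c f l p) =
    - (n%:R - 3) * cov3 Q b c f l - tr (fun m p => a b * a m * C c f l p).
  have : cov3 (fun j k l => tr (fun m p => a m * C j k l p)) b c f l =
      - (n%:R - 3) * cov3 Q b c f l.
    rewrite (eq_cov3 _ _ _ _ divE) /cov3 DM DN DB Dn (Dn b 3) !conn_actZ; ring.
  rewrite cov3_weyl_divergence trD => <-.
  rewrite -[LHS]addr0 -addrA; congr (_ + _); rewrite -trB; symmetry.
  by apply: tr0 => m p; rewrite recC; ring.
rewrite /cyclic_contraction !trD !e.
have := cyclic_recurrence_vector cT Ps weyl_traceless n_eq Q_skew recurrent_bianchi i j k l.
rewrite /cyclic_contraction !trD => W0.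
transitivity (- (n%:R - 3) * (cov3 Q i j k l + cov3 Q j k i l + cov3 Q k i j l)).
  by rewrite -[RHS]subr0 -W0; ring.
congr (_ * _).
have Qe b c f : cov3 Q b c f l =
    cov3 (cov2 schouten) b c f l - cov3 (cov2 schouten) b f c l.
  by rewrite /cov3 /Q DB !conn_actB; ring.
rewrite /X (cyclic_contraction_weyl_part _ Ps).
have r2 := ricci_identity2 schouten.
transitivity (
  (cov3 (cov2 schouten) i j k l - cov3 (cov2 schouten) j i k l)
  + (cov3 (cov2 schouten) j k i l - cov3 (cov2 schouten) k j i l)
  + (cov3 (cov2 schouten) k i j l - cov3 (cov2 schouten) i k j l)).
  by rewrite !Qe; ring.
(* The curvature acting on the first slot of [schouten] cancels by the first Bianchi identity; the
   action on the second slot is the wanted contraction. *)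
have cyc0 : rs i j k (fun m => schouten m l) + rs j k i (fun m => schouten m l)
    + rs k i j (fun m => schouten m l) = 0.
  rewrite -!big_split big1 // => p _ /=.
  by rewrite -!mulrDl curvature_cyc mul0r.
rewrite !r2 -riemann_compatE !big_split /=.
have e2 b c f : rs b c l (fun m => schouten f m) =
    \sum_m schouten f m * curvature b c l m.
  by apply: eq_bigr => m _; rewrite mulrC.
by rewrite !e2; apply: (subr_eq_trans cyc0); ring.
Qed.

Let curl i j k l :
  cyclic_contraction (fun i j => cov1 a i j - cov1 a j i) C i j k l
  = - (n%:R - 4) * X i j k l.
Proof.
have ricci_id i' j' k' l' m q := ricci_identity_recurrent recC i' j' k' l' m q.
apply: (cyclic_commutator cT Ps weyl_traceless
  (F := fun i j => cov1 a i j - cov1 a j i)) => i' j' k' l' m q.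
by rewrite ricci_id !curv_act_tr.
Qed.

Lemma cyclic_ricci T : curvature_like T -> forall i j k l,
  cyclic_contraction ricci_tens T i j k l =
  (n%:R - 2) * cyclic_contraction schouten T i j k l.
Proof.
move=> cT' i j k l.
rewrite -[RHS]addr0 -(mulr0 (half * c1 * scalar_curv)).
rewrite -(cyclic_contraction_metric cT' i j k l) -!cyclic_contractionZ.
rewrite -cyclic_contractionD.
by apply: eq_tr => m p; rewrite !ricci_schouten.
Qed.

Let compat (K : 'I_n -> 'I_n -> 'I_n -> 'I_n -> A) b := forall i j k l,
  \sum_m (b i m * K j k l m + b j m * K k i l m + b k m * K i j l m) = 0.

Lemma conformally_recurrent_compatible :
  [/\ compat weyl_mixed (fun i j => a i * a j),
      compat weyl_mixed (fun i j => cov1 a i j + cov1 a j i + ricci_tens i j),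
      compat weyl_mixed (fun i j => cov1 a i j - cov1 a j i
                         + (n%:R - 4) * c2 * ricci_tens i j)
    & (forall i j, cov1 a i j = cov1 a j i) ->
      [/\ compat weyl_mixed (cov1 a), compat weyl_mixed ricci_tens
        & compat curvature ricci_tens]].
Proof.
have Q_skew j' k' l' : Q j' k' l' = - Q k' j' l' by rewrite /Q; ring.
have Y := cyclic_cov_recurrence_vector.
have R i j k l : cyclic_contraction ricci_tens C i j k l = (n%:R - 2) * X i j k l.
  exact: cyclic_ricci.
split=> [i j k l|i j k l|i j k l|closed].
- rewrite (weyl_compatE (fun i j => a i * a j)).
  exact: (cyclic_recurrence_vector cT Ps weyl_traceless n_eq Q_skew recurrent_bianchi).
- rewrite (weyl_compatE (fun i j => cov1 a i j + cov1 a j i + ricci_tens i j)).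
  (* The coefficients of [X] are [- 2 (n - 3)], [n - 4] and [n - 2], with sum zero. *)
  transitivity (2 * cyclic_contraction (cov1 a) C i j k l
    - cyclic_contraction (fun i j => cov1 a i j - cov1 a j i) C i j k l
    + cyclic_contraction ricci_tens C i j k l); last by rewrite Y curl R; ring.
  by rewrite -trZ -trB -trD; apply: eq_tr => m p; ring.
- rewrite (weyl_compatE (fun i j => cov1 a i j - cov1 a j i
    + (n%:R - 4) * c2 * ricci_tens i j)).
  rewrite cyclic_contractionD cyclic_contractionZ curl R.
  by rewrite mulrA -(mulrA _ c2) c2E; ring.
- have X0 i j k l : X i j k l = 0.
    (* The curl is zero for closed [a], so [curl] reads [(n - 4) X = 0]. *)
    apply: (@natr_regular d).
    have : cyclic_contraction (fun i j => cov1 a i j - cov1 a j i) C i j k l = 0.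
      by apply: tr0 => m p; rewrite (closed m i) (closed m j) (closed m k); ring.
    by rewrite curl n_eq !mulrS => h; rewrite -[RHS]oppr0 -h; ring.
  split=> i j k l; rewrite ?weyl_compatE ?riemann_compatE.
  + by rewrite Y X0 mulr0.
  + by rewrite R X0 mulr0.
  + rewrite (cyclic_ricci cT) -(cyclic_contraction_weyl_part _ Ps).
    by rewrite -/(X i j k l) X0 mulr0.
Qed.

End ConformallyRecurrent.
End Derivations.
End MetricTrace.

(** * Smooth functions *)

Section Schwarz.
Variables (R : realType) (V : normedModType R).
Implicit Types (f : V -> R) (x y u v : V).

Lemma is_derive_line f y u t : derivable f (t *: u + y) u ->
  is_derive t 1 (fun s => f (s *: u + y)) ('D_u f (t *: u + y)).
Proof.
have e : (fun h : R => h^-1 *: (((fun s => f (s *: u + y)) \o shift t) (h *: 1)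
      - f (t *: u + y))) =
    (fun h => h^-1 *: ((f \o shift (t *: u + y)) (h *: u) - f (t *: u + y))).
  by apply/funext => h /=; rewrite [h *: 1]mulr1 scalerDl addrA.
by move=> df; split; rewrite /derivable /derive e.
Qed.

Lemma MVT_line f y u h : 0 < h ->
  (forall t, 0 <= t <= h -> derivable f (t *: u + y) u) ->
  exists2 t, 0 < t < h & f (h *: u + y) - f y = h * 'D_u f (t *: u + y).
Proof.
move=> h0 df.
have [||c ch e] := @MVT R (fun s => f (s *: u + y))
    (fun t => 'D_u f (t *: u + y)) 0 h h0.
- move=> t; rewrite in_itv /= => /andP[t0 th].
  by apply: is_derive_line; apply: df; rewrite !ltW.
- apply: derivable_within_continuous => t; rewrite in_itv /= => th.
  by apply: ex_derive; apply: is_derive_line; exact: df.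
exists c; first by move: ch; rewrite in_itv.
by move: e; rewrite scale0r add0r subr0 mulrC.
Qed.

(** The mean value theorem is used twice: along [u] for the increment [F] in direction [h v], then
    along [v] for ['D_u f]. *)
Lemma second_difference_MVT f x u v h : 0 < h ->
  (forall s t, 0 <= s <= h -> 0 <= t <= h ->
    derivable f (s *: u + (t *: v + x)) u /\
    derivable ('D_u f) (s *: u + (t *: v + x)) v) ->
  exists s t, [/\ 0 < s < h, 0 < t < h &
    f (h *: u + (h *: v + x)) - f (h *: u + x) - f (h *: v + x) + f x =
    h * h * 'D_v ('D_u f) (s *: u + (t *: v + x))].
Proof.
move=> h0 df.
have h00 : 0 <= h <= h by rewrite lexx ltW.
have h01 : 0 <= (0 : R) <= h by rewrite lexx ltW.
pose F y := f (h *: v + y) - f y.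
have sh y : (fun z => f (h *: v + z)) = f \o shift (h *: v).
  by apply/funext => z /=; rewrite addrC.
have dF s : 0 <= s <= h -> is_derive (s *: u + x) u F
    ('D_u f (s *: u + (h *: v + x)) - 'D_u f (s *: u + x)).
  move=> sh'.
  have [d1 _] := df s h sh' h00; have [d2 _] := df s 0 sh' h01.
  apply: is_deriveB; last first.
    by apply: derivableP; move: d2; rewrite scale0r add0r.
  have e : (fun r : R => r^-1 *: (((fun y => f (h *: v + y)) \o shift (s *: u + x)) (r *: u)
      - f (h *: v + (s *: u + x)))) =
    (fun r => r^-1 *: ((f \o shift (s *: u + (h *: v + x))) (r *: u)
      - f (s *: u + (h *: v + x)))).
    apply/funext => r /=; congr (_ *: (f _ - f _)).
      by rewrite addrCA (addrCA _ (s *: u)).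
    by rewrite addrCA.
  split; first by rewrite /derivable e; exact: d1.
  by rewrite /derive e.
have [|s sh0 e] := @MVT_line F x u h h0.
  by move=> t th; apply: ex_derive; exact: dF.
have s1 : 0 <= s <= h by case/andP: sh0 => s0 s1; rewrite !ltW.
rewrite (@derive_val _ _ _ _ _ _ _ (dF s s1)) in e.
have [|t th e2] := @MVT_line ('D_u f) (s *: u + x) v h h0.
  move=> t th; rewrite addrCA.
  by have [] := df s t s1 th.
exists s, t; split; [exact: sh0|exact: th|].
rewrite addrCA in e2.
rewrite -mulrA [t *: v + _]addrCA in e2 *.
rewrite -e2 -e /F.
by rewrite (addrCA (h *: v)); ring.
Qed.

Lemma disjoint_half_balls (a b p q : R) : p = q ->
  `|a - p| < `|a - b| / 2 -> `|b - q| < `|a - b| / 2 -> False.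
Proof.
move=> -> pa pb; have := ler_normD (a - q) (q - b).
by rewrite addrA subrK (distrC q); lra.
Qed.

(** The second difference is symmetric in [u] and [v], so both mixed derivatives take a common value
    at points close to [x]; by continuity their values at [x] cannot differ. *)
Lemma Schwarz_symmetry f x u v :
  (\forall y \near x, [/\ derivable f y u, derivable f y v,
     derivable ('D_u f) y v & derivable ('D_v f) y u]) ->
  {for x, continuous ('D_v ('D_u f))} -> {for x, continuous ('D_u ('D_v f))} ->
  'D_v ('D_u f) x = 'D_u ('D_v f) x.
Proof.
pose a := 'D_v ('D_u f); pose b := 'D_u ('D_v f).
move=> nf ca cb; suff : a x = b x by [].
apply/eqP; rewrite -subr_eq0 -normr_le0 leNgt; apply/negP => ab0.
have e0 : 0 < `|a x - b x| / 2 by rewrite divr_gt0.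
have na : \forall y \near x, `|a x - a y| < `|a x - b x| / 2.
  by move/cvgrPdist_lt : ca; apply.
have nb : \forall y \near x, `|b x - b y| < `|a x - b x| / 2.
  by move/cvgrPdist_lt : cb; apply.
have : \forall y \near x, [/\ [/\ derivable f y u, derivable f y v,
     derivable ('D_u f) y v & derivable ('D_v f) y u],
     `|a x - a y| < `|a x - b x| / 2 & `|b x - b y| < `|a x - b x| / 2].
  by apply: filterS3 nf na nb => y; split.
move=> /nbhs_ballP[/= d d0 dP].
(* With [h = d / (2 M)] the parallelogram of sides [h u] and [h v] at [x] lies in the ball of radius
   [d]; the [+ 1] keeps [M] positive. *)
pose M := `|u| + `|v| + 1.
have M0 : 0 < M by rewrite ltr_wpDl// addr_ge0.
pose h := d / (M + M).
have h0 : 0 < h by rewrite divr_gt0// addr_gt0.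
have inb s t : 0 <= s <= h -> 0 <= t <= h -> ball x d (s *: u + (t *: v + x)).
  move=> /andP[s0 sh] /andP[t0 th].
  rewrite -ball_normE /= addrA opprD addrCA subrr addr0 normrN.
  apply: (le_lt_trans (ler_normD _ _)); rewrite !normrZ !ger0_norm//.
  apply: (@le_lt_trans _ _ (h * `|u| + h * `|v|)).
    by apply: lerD; rewrite ler_wpM2r.
  have -> : d = h * (M + M) by rewrite /h divfK// gt_eqF// addr_gt0.
  rewrite -mulrDr ltr_pM2l// /M.
  have := normr_ge0 u; have := normr_ge0 v; lra.
have [|s [t [/andP[s0 sh] /andP[t0 th] e1]]] := @second_difference_MVT f x u v h h0.
  move=> s t sh th; have [[d1 _ d2 _] _ _] := dP _ (inb s t sh th).
  by split; [exact: d1|exact: d2].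
have [|s' [t' [/andP[s0' sh'] /andP[t0' th'] e2]]] :=
    @second_difference_MVT f x v u h h0.
  move=> s' t' sh' th'; have := inb t' s' th' sh'; rewrite addrCA => /dP[].
  by move=> [_ d1 _ d2] _ _; split; [exact: d1|exact: d2].
have inI (r : R) : 0 < r -> r < h -> 0 <= r <= h by move=> r0 rh; rewrite !ltW.
have [_ pa _] := dP _ (inb s t (inI _ s0 sh) (inI _ t0 th)).
have := inb t' s' (inI _ t0' th') (inI _ s0' sh').
rewrite addrCA => /dP[_ _ pb].
have ab : a (s *: u + (t *: v + x)) = b (s' *: v + (t' *: u + x)).
  apply: (mulfI (lt0r_neq0 (mulr_gt0 h0 h0))).
  rewrite -[LHS]e1 -[RHS]e2 (addrCA (h *: v)); ring.
apply: (disjoint_half_balls ab); [exact: pa|exact: pb].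
Qed.
End Schwarz.

(** * Stability of smooth functions on an open set *)

Section SmoothAlgebra.
Variables (R : realType) (n : nat) (U : set 'rV[R]_n).
Hypothesis oU : open U.
Local Notation V := 'rV[R]_n.
Implicit Types (f g : V -> R) (x : V) (i j : 'I_n).

Lemma near_eq_on f g x : (forall y, U y -> f y = g y) -> U x ->
  \forall y \near x, f y = g y.
Proof.
move=> fg Ux; have : nbhs x U by exact: open_nbhs_nbhs.
by apply: filterS => y; exact: fg.
Qed.

Lemma eq_partial i f g x : (forall y, U y -> f y = g y) -> U x ->
  partial i f x = partial i g x.
Proof. by move=> fg Ux; apply: near_eq_derive; exact: near_eq_on. Qed.

(* Closure of the smooth functions under the pointwise algebraic operations;
   its elements are smooth because it is stable under partial derivatives. *)
Inductive smooth_closure : (V -> R) -> Prop :=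
| SmoothBase f of smooth_on U f : smooth_closure f
| SmoothConst c : smooth_closure (fun=> c)
| SmoothAdd f g of smooth_closure f & smooth_closure g :
    smooth_closure (fun x => f x + g x)
| SmoothMul f g of smooth_closure f & smooth_closure g :
    smooth_closure (fun x => f x * g x)
| SmoothInv f of smooth_closure f & (forall x, U x -> f x != 0) :
    smooth_closure (fun x => (f x)^-1).

Lemma smooth_closure_regular f : smooth_closure f -> forall x, U x ->
  {for x, continuous f} /\ forall i, derivable f x (delta_mx 0 i).
Proof.
elim=> {f} [f sf|c|f g _ IHf _ IHg|f g _ IHf _ IHg|f _ IHf f0] x Ux.
- exact: (sf [::]).
- by split=> [|i]; [exact: cst_continuous|exact: derivable_cst].
- have [cf df] := IHf x Ux; have [cg dg] := IHg x Ux.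
  by split=> [|i]; [exact: continuousD|exact: derivableD].
- have [cf df] := IHf x Ux; have [cg dg] := IHg x Ux.
  by split=> [|i]; [exact: continuousM|exact: derivableM].
- have [cf df] := IHf x Ux.
  by split=> [|i]; [apply: continuousV|apply: derivableV] => //; exact: f0.
Qed.

(** The rules of differentiation apply on [U], so the derivative is identified there only; as [U] is
    open, this suffices for iterating. *)
Lemma smooth_closure_partial f i : smooth_closure f ->
  exists2 g, smooth_closure g & forall x, U x -> partial i f x = g x.
Proof.
elim=> {f} [f sf|c|f g sf [f' sf' ef] sg [g' sg' eg]
  |f g sf [f' sf' ef] sg [g' sg' eg]|f sf [f' sf' ef] f0].
- exists (partial i f) => //; apply: SmoothBase => s x Ux.
  by rewrite /partials -foldr_rcons; exact: sf.
- exists (fun=> 0); first exact: SmoothConst.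
  by move=> x _; exact: derive_cst.
- exists (fun x => f' x + g' x); first exact: SmoothAdd.
  move=> x Ux; rewrite -ef// -eg//.
  have [_ df] := smooth_closure_regular sf Ux.
  have [_ dg] := smooth_closure_regular sg Ux.
  exact: deriveD.
- exists (fun x => f x * g' x + g x * f' x).
    by apply: SmoothAdd; exact: SmoothMul.
  move=> x Ux; rewrite -ef// -eg//.
  have [_ df] := smooth_closure_regular sf Ux.
  have [_ dg] := smooth_closure_regular sg Ux.
  exact: deriveM.
- exists (fun x => -1 * ((f x)^-1 * (f x)^-1) * f' x).
    by do ?[exact: SmoothConst|exact: SmoothInv|apply: SmoothMul].
  move=> x Ux; rewrite -ef//; have [_ df] := smooth_closure_regular sf Ux.
  rewrite mulN1r -expr2 exprVn; exact: (deriveV (f0 x Ux)).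
Qed.

Lemma smooth_closure_smooth f : smooth_closure f -> smooth_on U f.
Proof.
move=> sf s x Ux.
have [g sg e] : exists2 g, smooth_closure g &
    forall y, U y -> partials s f y = g y.
  elim: s => [|i s [g sg e]]; first by exists f.
  have [g' sg' e'] := smooth_closure_partial i sg.
  by exists g' => // y Uy; rewrite -e'//; exact: eq_partial.
have [cg dg] := smooth_closure_regular sg Ux.
have eg : \forall y \near x, g y = partials s f y.
  by apply: near_eq_on => // y Uy; rewrite e.
split=> [|i]; last exact: near_eq_derivable (dg i).
suff : partials s f y @[y --> x] --> partials s f x by [].
rewrite (e x Ux); apply: cvg_trans cg.
by apply: (near_eq_cvg (F := nbhs x)); apply: filterS eg => y ->.
Qed.

Lemma smooth_closure_eq f g : (forall x, U x -> f x = g x) ->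
  smooth_closure f -> smooth_on U g.
Proof.
move=> fg /smooth_closure_smooth sf s x Ux.
have e y : U y -> partials s f y = partials s g y.
  elim: s y => [|i s IHs] y Uy; first exact: fg.
  exact: eq_partial.
have [cf df] := sf s x Ux.
have efg := near_eq_on e Ux.
split=> [|i]; last exact: near_eq_derivable (df i).
suff : partials s g y @[y --> x] --> partials s g x by [].
rewrite -(e x Ux); apply: cvg_trans cf.
by apply: (near_eq_cvg (F := nbhs x)); apply: filterS efg => y ->.
Qed.

Lemma smooth_closure_sum (I : Type) (r : seq I) (P : pred I) (F : I -> V -> R) :
  (forall k, smooth_closure (F k)) ->
  smooth_closure (fun x => \sum_(k <- r | P k) F k x).
Proof.
move=> sF; elim: r => [|k r IHr].
  by under eq_fun do rewrite big_nil; exact: SmoothConst.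
under eq_fun do rewrite big_cons.
by case: (P k) => //; exact: SmoothAdd.
Qed.

Lemma smooth_closure_prod (I : Type) (r : seq I) (P : pred I) (F : I -> V -> R) :
  (forall k, smooth_closure (F k)) ->
  smooth_closure (fun x => \prod_(k <- r | P k) F k x).
Proof.
move=> sF; elim: r => [|k r IHr].
  by under eq_fun do rewrite big_nil; exact: SmoothConst.
under eq_fun do rewrite big_cons.
by case: (P k) => //; exact: SmoothMul.
Qed.

Lemma smooth_closure_det m (B : V -> 'M[R]_m) :
  (forall k l, smooth_closure (fun x => B x k l)) ->
  smooth_closure (fun x => \det (B x)).
Proof.
move=> sB; apply: smooth_closure_sum => s.
by apply: SmoothMul; [exact: SmoothConst|exact: smooth_closure_prod].
Qed.

(** By Cramer's formula the entries are cofactors divided by the determinant. *)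
Lemma smooth_invmx m (B : V -> 'M[R]_m) (i j : 'I_m) :
  (forall k l, smooth_on U (fun x => B x k l)) ->
  (forall x, U x -> B x \in unitmx) ->
  smooth_on U (fun x => invmx (B x) i j).
Proof.
move=> sB uB.
apply: (@smooth_closure_eq (fun x => (\det (B x))^-1 * cofactor (B x) j i)).
  by move=> x Ux; rewrite /invmx uB// !mxE.
have sB' k l : smooth_closure (fun x => B x k l) by exact/SmoothBase/sB.
apply: SmoothMul.
  apply: SmoothInv; first exact: smooth_closure_det.
  by move=> x Ux; rewrite -unitfE -unitmxE uB.
apply: SmoothMul; first exact: SmoothConst.
apply: smooth_closure_det => k l.
by under eq_fun do rewrite !mxE.
Qed.

Lemma smooth_partial i f : smooth_on U f -> smooth_on U (partial i f).
Proof. by move=> sf s x Ux; rewrite /partials -foldr_rcons; exact: sf. Qed.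

Lemma partialC i j f x : smooth_on U f -> U x ->
  partial i (partial j f) x = partial j (partial i f) x.
Proof.
move=> sf Ux; apply: Schwarz_symmetry.
- have : nbhs x U by exact: open_nbhs_nbhs.
  apply: filterS => y Uy; split.
  + by have [_] := sf [::] y Uy; apply.
  + by have [_] := sf [::] y Uy; apply.
  + by have [_] := sf [:: j] y Uy; apply.
  + by have [_] := sf [:: i] y Uy; apply.
- by have [] := sf [:: i; j] x Ux.
- by have [] := sf [:: j; i] x Ux.
Qed.

End SmoothAlgebra.

(* Values outside [U] are normalised to [0] so that equality of smooth functions is equality on [U]. *)
Record smoothFun (R : realType) (n : nat) (U : set 'rV[R]_n) (oU : open U) := SmoothFun {
  smooth_val :> 'rV[R]_n -> R;
  smooth_valP : smooth_on U smooth_val;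
  smooth_out : forall x, ~ U x -> smooth_val x = 0
}.

(** * The differential ring of smooth functions *)

Section SmoothFunctions.
Variables (R : realType) (n : nat) (U : set 'rV[R]_n) (oU : open U).
Implicit Types (F K : smoothFun oU) (f : 'rV[R]_n -> R).

Lemma smoothFunP F K : (forall x, U x -> F x = K x) -> F = K.
Proof.
case: F K => [f sf f0] [k sk k0] /= fk.
have {}fk : f = k.
  apply/funext => x; have [Ux|nUx] := pselect (U x); first exact: fk.
  by rewrite f0// k0.
by rewrite fk in sf f0 *; congr (SmoothFun oU); exact: Prop_irrelevance.
Qed.

Definition restrict_zero f x : R := if pselect (U x) then f x else 0.

Lemma restrict_zeroE f x : U x -> restrict_zero f x = f x.
Proof. by rewrite /restrict_zero; case: pselect. Qed.

Lemma restrict_zero_out f x : ~ U x -> restrict_zero f x = 0.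
Proof. by rewrite /restrict_zero; case: pselect. Qed.

Lemma smooth_restrict_zero f : smooth_closure U f -> smooth_on U (restrict_zero f).
Proof.
apply: smooth_closure_eq; first exact: oU.
by move=> x Ux; rewrite restrict_zeroE.
Qed.

Definition smooth_fun f (sf : smooth_closure U f) : smoothFun oU :=
  SmoothFun oU (smooth_restrict_zero sf) (@restrict_zero_out f).

Lemma smooth_funE f (sf : smooth_closure U f) x : U x -> smooth_fun sf x = f x.
Proof. exact: restrict_zeroE. Qed.

Lemma smoothFun_closure F : smooth_closure U F.
Proof. exact/SmoothBase/smooth_valP. Qed.

Definition smooth_cst c := smooth_fun (SmoothConst U c).
Definition smooth_add F K :=
  smooth_fun (SmoothAdd (smoothFun_closure F) (smoothFun_closure K)).
Definition smooth_mul F K :=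
  smooth_fun (SmoothMul (smoothFun_closure F) (smoothFun_closure K)).
Definition smooth_opp F := smooth_mul (smooth_cst (-1)) F.
Definition smooth_partial_fun i F : smoothFun oU :=
  smooth_fun (SmoothBase (smooth_partial i (smooth_valP F))).

HB.instance Definition _ := gen_eqMixin (smoothFun oU).
HB.instance Definition _ := gen_choiceMixin (smoothFun oU).

Lemma smooth_addA : associative smooth_add.
Proof. by move=> F K L; apply: smoothFunP => x Ux; rewrite !smooth_funE// addrA. Qed.
Lemma smooth_addC : commutative smooth_add.
Proof. by move=> F K; apply: smoothFunP => x Ux; rewrite !smooth_funE// addrC. Qed.
Lemma smooth_add0 : left_id (smooth_cst 0) smooth_add.
Proof. by move=> F; apply: smoothFunP => x Ux; rewrite !smooth_funE// add0r. Qed.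
Lemma smooth_addN : left_inverse (smooth_cst 0) smooth_opp smooth_add.
Proof.
by move=> F; apply: smoothFunP => x Ux; rewrite !smooth_funE// mulN1r addNr.
Qed.
HB.instance Definition _ := GRing.isZmodule.Build (smoothFun oU)
  smooth_addA smooth_addC smooth_add0 smooth_addN.

Lemma smooth_mulA : associative smooth_mul.
Proof. by move=> F K L; apply: smoothFunP => x Ux; rewrite !smooth_funE// mulrA. Qed.
Lemma smooth_mulC : commutative smooth_mul.
Proof. by move=> F K; apply: smoothFunP => x Ux; rewrite !smooth_funE// mulrC. Qed.
Lemma smooth_mul1 : left_id (smooth_cst 1) smooth_mul.
Proof. by move=> F; apply: smoothFunP => x Ux; rewrite !smooth_funE// mul1r. Qed.
Lemma smooth_mulDl : left_distributive smooth_mul +%R.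
Proof. by move=> F K L; apply: smoothFunP => x Ux; rewrite !smooth_funE// mulrDl. Qed.
(** [U] may be empty, and then [1 = 0]; hence a ring structure that allows the zero ring. *)
HB.instance Definition _ := GRing.Zmodule_isComPzRing.Build (smoothFun oU)
  smooth_mulA smooth_mulC smooth_mul1 smooth_mulDl.

Section Evaluation.
Variable x : 'rV[R]_n.
Hypothesis Ux : U x.

Lemma smooth_evalD F K : (F + K) x = F x + K x. Proof. exact: smooth_funE. Qed.
Lemma smooth_evalM F K : (F * K) x = F x * K x. Proof. exact: smooth_funE. Qed.
Lemma smooth_eval0 : (0 : smoothFun oU) x = 0. Proof. exact: smooth_funE. Qed.
Lemma smooth_eval1 : (1 : smoothFun oU) x = 1. Proof. exact: smooth_funE. Qed.
Lemma smooth_evalN F : (- F) x = - F x.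
Proof. by rewrite [LHS]smooth_funE// smooth_funE// mulN1r. Qed.
Lemma smooth_evalB F K : (F - K) x = F x - K x.
Proof. by rewrite smooth_evalD smooth_evalN. Qed.
Lemma smooth_eval_nat k : (k%:R : smoothFun oU) x = k%:R.
Proof.
by elim: k => [|k IHk]; rewrite ?smooth_eval0// !mulrS smooth_evalD IHk smooth_eval1.
Qed.
Lemma smooth_eval_sum (I : Type) (r : seq I) (P : pred I) (F : I -> smoothFun oU) :
  (\sum_(i <- r | P i) F i) x = \sum_(i <- r | P i) F i x.
Proof.
exact: (big_morph (fun F : smoothFun oU => F x) smooth_evalD smooth_eval0).
Qed.
Lemma smooth_eval_partial i F f : (forall y, U y -> F y = f y) ->
  smooth_partial_fun i F x = partial i f x.
Proof.
by move=> Ff; rewrite smooth_funE//; apply: (eq_partial oU).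
Qed.
End Evaluation.

Lemma smooth_partial_funD i F K : smooth_partial_fun i (F + K) =
  smooth_partial_fun i F + smooth_partial_fun i K.
Proof.
apply: smoothFunP => x Ux; rewrite smooth_evalD//.
rewrite (@smooth_eval_partial x Ux i _ (fun y => F y + K y)) ?smooth_funE//;
  last by move=> y Uy; rewrite smooth_evalD.
have [_ dF] := smooth_valP F [::] Ux; have [_ dK] := smooth_valP K [::] Ux.
exact: deriveD.
Qed.

Lemma smooth_partial_funM i F K : smooth_partial_fun i (F * K) =
  smooth_partial_fun i F * K + F * smooth_partial_fun i K.
Proof.
apply: smoothFunP => x Ux; rewrite smooth_evalD// !smooth_evalM//.
rewrite (@smooth_eval_partial x Ux i _ (fun y => F y * K y)) ?smooth_funE//;
  last by move=> y Uy; rewrite smooth_evalM.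
have [_ dF] := smooth_valP F [::] Ux; have [_ dK] := smooth_valP K [::] Ux.
rewrite addrC [X in _ + X]mulrC; exact: deriveM.
Qed.

Lemma smooth_partial_funC i j F :
  smooth_partial_fun i (smooth_partial_fun j F) =
  smooth_partial_fun j (smooth_partial_fun i F).
Proof.
apply: smoothFunP => x Ux.
have e a b : smooth_partial_fun a (smooth_partial_fun b F) x =
    partial a (partial b F) x.
  apply: (@smooth_eval_partial x Ux a (smooth_partial_fun b F) (partial b F)).
  by move=> y Uy; exact: (@smooth_eval_partial y Uy b F F).
exact: (etrans (e i j) (etrans (partialC oU i j (smooth_valP F) Ux) (esym (e j i)))).
Qed.

Lemma smooth_natr_regular k F : k.+1%:R * F = 0 -> F = 0.
Proof.
move=> e; apply: smoothFunP => x Ux.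
have := congr1 (fun K : smoothFun oU => K x) e.
rewrite smooth_evalM// smooth_eval_nat// smooth_eval0//.
by move/eqP; rewrite mulf_eq0 pnatr_eq0 => /eqP.
Qed.

Lemma smooth_cstE c x : U x -> smooth_cst c x = c.
Proof. exact: smooth_funE. Qed.

End SmoothFunctions.

(** * Transfer of the algebraic result to a coordinate chart *)

Section LocalTheorem.
Variables (R : realType) (n : nat) (U : set 'rV[R]_n) (oU : open U).
Variables (g : 'rV[R]_n -> 'M[R]_n) (alpha : 'I_n -> 'rV[R]_n -> R).
Hypothesis g_smooth : forall i j, smooth_on U (fun x => g x i j).
Hypothesis g_sym : forall x, U x -> (g x)^T = g x.
Hypothesis g_unit : forall x, U x -> g x \in unitmx.
Hypothesis alpha_smooth : forall i, smooth_on U (alpha i).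
Hypothesis n_ge5 : (5 <= n)%N.

Local Notation A := (smoothFun oU).
Let G i j : A := smooth_fun oU (SmoothBase (g_smooth i j)).
Let H i j : A := smooth_fun oU (SmoothBase (smooth_invmx oU i j g_smooth g_unit)).
Let a i : A := smooth_fun oU (SmoothBase (alpha_smooth i)).
Let D : 'I_n -> A -> A := @smooth_partial_fun R n U oU.
Let half : A := smooth_cst oU 2^-1.
Let c1 : A := smooth_cst oU (n%:R - 1)^-1.
Let c2 : A := smooth_cst oU (n%:R - 2)^-1.

(** Ring elements vanish outside [U] while chart components are arbitrary there, so the two are
    compared on [U]. *)
Let agree (F : A) (f : 'rV[R]_n -> R) := forall x, U x -> F x = f x.

Let GE i j : agree (G i j) (fun x => g x i j).
Proof. by move=> x; exact: smooth_funE. Qed.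
Let HE i j : agree (H i j) (invg g i j).
Proof. by move=> x; exact: smooth_funE. Qed.
Let aE i : agree (a i) (alpha i).
Proof. by move=> x; exact: smooth_funE. Qed.
Let DE i F f : agree F f -> agree (D i F) (partial i f).
Proof. by move=> Ff x Ux; exact: (@smooth_eval_partial _ _ _ oU x Ux i F f Ff). Qed.

Let Gsym i j : G i j = G j i.
Proof. by apply: smoothFunP => x Ux; rewrite !GE// -{1}g_sym// mxE. Qed.
Let Hsym i j : H i j = H j i.
Proof.
by apply: smoothFunP => x Ux; rewrite !HE// /invg -{1}g_sym// -trmx_inv mxE.
Qed.
Let HG i k : \sum_m H i m * G m k = (i == k)%:R.
Proof.
apply: smoothFunP => x Ux; rewrite smooth_eval_sum// smooth_eval_nat//.
transitivity ((invmx (g x) *m g x) i k); last by rewrite mulVmx ?g_unit// mxE.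
by rewrite mxE; apply: eq_bigr => m _; rewrite smooth_evalM// GE// HE.
Qed.
Let half2 : half * 2 = 1.
Proof.
apply: smoothFunP => x Ux; rewrite smooth_evalM// (smooth_eval_nat _ Ux 2).
by rewrite smooth_eval1// smooth_cstE// mulVf.
Qed.

Let nB k : (k < 5)%N -> (n%:R - k%:R : R) != 0.
Proof. by move=> k5; rewrite subr_eq0 eqr_nat gtn_eqF// (leq_trans k5). Qed.

Let c1E : c1 * (n%:R - 1) = 1.
Proof.
apply: smoothFunP => x Ux; rewrite smooth_evalM// smooth_evalB//.
by rewrite smooth_eval_nat// !smooth_eval1// smooth_cstE// mulVf// (@nB 1).
Qed.
Let c2E : c2 * (n%:R - 2) = 1.
Proof.
apply: smoothFunP => x Ux; rewrite smooth_evalM// smooth_evalB//.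
by rewrite !(smooth_eval_nat _ Ux) !smooth_eval1// smooth_cstE// mulVf// (@nB 2).
Qed.

(** In this form an evaluation is proved by following the syntax of the expression. *)
Let evD (F K : A) x u v : U x -> F x = u -> K x = v -> (F + K) x = u + v.
Proof. by move=> Ux <- <-; exact: smooth_evalD. Qed.
Let evB (F K : A) x u v : U x -> F x = u -> K x = v -> (F - K) x = u - v.
Proof. by move=> Ux <- <-; exact: smooth_evalB. Qed.
Let evN (F : A) x u : U x -> F x = u -> (- F) x = - u.
Proof. by move=> Ux <-; exact: smooth_evalN. Qed.
Let evM (F K : A) x u v : U x -> F x = u -> K x = v -> (F * K) x = u * v.
Proof. by move=> Ux <- <-; exact: smooth_evalM. Qed.
Let evS (F : 'I_n -> A) x u : U x -> (forall i, F i x = u i) ->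
  (\sum_i F i) x = \sum_i u i.
Proof.
by move=> Ux e; rewrite (smooth_eval_sum Ux); apply: eq_bigr => i _; exact: e.
Qed.

Let connectionE m i j : agree (connection G H D half m i j) (christoffel g m i j).
Proof.
move=> x Ux; apply: (evM Ux); first exact: smooth_cstE.
apply: (evS Ux) => p; apply: (evM Ux); first exact: HE.
apply: (evB Ux); last exact: (DE _ (GE i j) Ux).
apply: (evD Ux); [exact: (DE _ (GE j p) Ux)|exact: (DE _ (GE i p) Ux)].
Qed.

Let conn_actE i j (F : 'I_n -> A) f x : U x -> (forall m, F m x = f m) ->
  conn_act G H D half i j F x = \sum_m christoffel g m i j x * f m.
Proof.
by move=> Ux Ff; apply: (evS Ux) => m; apply: (evM Ux);
  [exact: connectionE|exact: Ff].
Qed.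

Let cov1E T t : (forall j, agree (T j) (t j)) ->
  forall i j, agree (cov1 G H D half T i j) (nabla1 g t i j).
Proof.
move=> Tt i j x Ux; apply: (evB Ux); first exact: (DE _ (Tt j) Ux).
by apply: (conn_actE _ _ Ux) => m; exact: Tt.
Qed.

Let cov2E T t : (forall j k, agree (T j k) (t j k)) ->
  forall i j k, agree (cov2 G H D half T i j k) (nabla2 g t i j k).
Proof.
move=> Tt i j k x Ux; do 2![apply: (evB Ux);
  last by apply: (conn_actE _ _ Ux) => m; exact: Tt].
exact: (DE _ (Tt j k) Ux).
Qed.

Let cov4E T t : (forall j k l m, agree (T j k l m) (t j k l m)) ->
  forall i j k l m, agree (cov4 G H D half T i j k l m) (nabla4 g t i j k l m).
Proof.
move=> Tt i j k l m x Ux; do 4![apply: (evB Ux);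
  last by apply: (conn_actE _ _ Ux) => p; exact: Tt].
exact: (DE _ (Tt j k l m) Ux).
Qed.

Let curvE j k l m : agree (curvature G H D half j k l m) (riemann g j k l m).
Proof.
have e p q : agree (cov1 G H D half (@coord_covec _ n m) p q)
    (nabla1 g (coord_covector m) p q).
  by apply: cov1E => r x Ux; exact: smooth_eval_nat.
by move=> x Ux; apply: (evB Ux); [exact: (cov2E e j k l Ux)|exact: (cov2E e k j l Ux)].
Qed.

Let ricciE k l : agree (ricci_tens G H D half k l) (ricci g k l).
Proof.
by move=> x Ux; apply: (evN Ux); apply: (evS Ux) => m; exact: (curvE m k l m Ux).
Qed.

Let ricci_upE j m : agree (ricci_mixed G H D half j m) (ricci_up g j m).
Proof.
move=> x Ux; apply: (evS Ux) => p; apply: (evM Ux); first exact: (ricciE j p Ux).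
exact: (HE p m Ux).
Qed.

Let scalarE : agree (scalar_curv G H D half) (scalar_curvature g).
Proof.
move=> x Ux; apply: (evS Ux) => i; apply: (evS Ux) => j; apply: (evM Ux).
  exact: (HE i j Ux).
exact: (ricciE i j Ux).
Qed.

Let weylE j k l m :
  agree (weyl_mixed G H D half c1 c2 j k l m) (weyl g j k l m).
Proof.
have delta (p q : 'I_n) x : U x -> ((p == q)%:R : A) x = (p == q)%:R.
  by move=> Ux; exact: smooth_eval_nat.
move=> x Ux; apply: (evB Ux); [apply: (evD Ux)|apply: (evM Ux)].
- exact: (curvE j k l m Ux).
- apply: (evM Ux); first exact: smooth_cstE.
  apply: (evB Ux); [apply: (evD Ux); [apply: (evB Ux)|]|]; apply: (evM Ux).
  + exact: delta.
  + exact: (ricciE k l Ux).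
  + exact: delta.
  + exact: (ricciE j l Ux).
  + exact: (ricci_upE j m Ux).
  + exact: (GE k l Ux).
  + exact: (ricci_upE k m Ux).
  + exact: (GE j l Ux).
- exact: (scalarE Ux).
- rewrite invfM; apply: (evM Ux).
    apply: (evB Ux); apply: (evM Ux).
    + exact: delta.
    + exact: (GE k l Ux).
    + exact: delta.
    + exact: (GE j l Ux).
  by apply: (evM Ux); exact: smooth_cstE.
Qed.

Let weyl_lowE j k l m :
  agree (weyl_lower G H D half c1 c2 j k l m) (weyl_low g j k l m).
Proof.
move=> x Ux; apply: (evS Ux) => p; apply: (evM Ux); first exact: (weylE j k l p Ux).
exact: (GE p m Ux).
Qed.

Let nablaE i j : agree (cov1 G H D half a i j) (nabla1 g alpha i j).
Proof. exact: cov1E. Qed.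

Hypothesis recurrent : forall x, U x -> forall i j k l m,
  nabla4 g (weyl_low g) i j k l m x = alpha i x * weyl_low g j k l m x.

Let compat_eval K k b' b :
  (forall i j l m, agree (K i j l m) (k i j l m)) ->
  (forall i j, agree (b' i j) (b i j)) ->
  (forall i j r l, \sum_m (b' i m * K j r l m + b' j m * K r i l m
     + b' r m * K i j l m) = 0) ->
  forall x, U x -> compatible_at k b x.
Proof.
move=> Kk bb e x Ux i j r l.
rewrite -[RHS](smooth_eval0 oU Ux) -(e i j r l); symmetry.
apply: (evS Ux) => m.
by apply: (evD Ux); [apply: (evD Ux)|]; apply: (evM Ux);
  (exact: (bb _ _ _ Ux) || exact: (Kk _ _ _ _ _ Ux)).
Qed.

Lemma local_conformally_recurrent_compatible :
  [/\ forall x, U x -> compatible_at (weyl g) (fun i j x => alpha i x * alpha j x) x,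
      forall x, U x -> compatible_at (weyl g) (fun i j x =>
        nabla1 g alpha i j x + nabla1 g alpha j i x + ricci g i j x) x,
      forall x, U x -> compatible_at (weyl g) (fun i j x =>
        nabla1 g alpha i j x - nabla1 g alpha j i x
        + (n%:R - 4) / (n%:R - 2) * ricci g i j x) x
    & (forall x, U x -> forall i j,
         nabla1 g alpha i j x = nabla1 g alpha j i x) ->
      [/\ forall x, U x -> compatible_at (weyl g) (nabla1 g alpha) x,
          forall x, U x -> compatible_at (weyl g) (ricci g) x
        & forall x, U x -> compatible_at (riemann g) (ricci g) x]].
Proof.
(* The parameter [d] of the algebraic part is [n - 5]. *)
have nE : n = (n - 5).+1.+4 := esym (subnKC n_ge5).
have rec i j k l m : cov4 G H D half (weyl_lower G H D half c1 c2) i j k l m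
    = a i * weyl_lower G H D half c1 c2 j k l m.
  apply: smoothFunP => x Ux.
  apply: (etrans (cov4E weyl_lowE i j k l m Ux)); rewrite recurrent//; symmetry.
  by apply: (evM Ux); [exact: (aE i Ux)|exact: (weyl_lowE j k l m Ux)].
have [k1 k2 k3 k4] := conformally_recurrent_compatible Hsym Gsym HG
  (@smooth_natr_regular _ _ _ oU) (@smooth_partial_funD _ _ _ oU)
  (@smooth_partial_funM _ _ _ oU) (@smooth_partial_funC _ _ _ oU)
  half2 nE c1E c2E rec.
split.
- apply: (compat_eval weylE _ k1) => i j x Ux.
  by apply: (evM Ux); [exact: (aE i Ux)|exact: (aE j Ux)].
- apply: (compat_eval weylE _ k2) => i j x Ux.
  apply: (evD Ux); last exact: (ricciE i j Ux).
  by apply: (evD Ux); [exact: (nablaE i j Ux)|exact: (nablaE j i Ux)].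
- apply: (compat_eval weylE _ k3) => i j x Ux.
  apply: (evD Ux); last apply: (evM Ux); last exact: (ricciE i j Ux).
    by apply: (evB Ux); [exact: (nablaE i j Ux)|exact: (nablaE j i Ux)].
  apply: (evM Ux); last exact: smooth_cstE.
  by apply: (evB Ux); exact: smooth_eval_nat.
- move=> closed; have [|l1 l2 l3] := k4.
    move=> i j; apply: smoothFunP => x Ux.
    apply: (etrans (nablaE i j Ux)); rewrite closed//.
    exact: (esym (nablaE j i Ux)).
  split.
  + exact: (compat_eval weylE nablaE l1).
  + exact: (compat_eval weylE ricciE l2).
  + exact: (compat_eval curvE ricciE l3).
Qed.

End LocalTheorem.

Theorem proposition2p2 (R : realType) (n : nat) (n_ge5 : (5 <= n)%N)
    (M : pseudoRiemannianManifold R n) (alpha : covectorField M)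
    (alpha_recurrent : conformally_recurrent alpha) :
  [/\ weyl_compatible (fun a i j x => alpha a i x * alpha a j x),
      weyl_compatible (fun a i j x =>
        nabla_covector alpha a i j x + nabla_covector alpha a j i x
        + ricci_tensor a i j x),
      weyl_compatible (fun a i j x =>
        nabla_covector alpha a i j x - nabla_covector alpha a j i x
        + (n%:R - 4) / (n%:R - 2) * ricci_tensor a i j x)
    & closed_covector alpha ->
      [/\ weyl_compatible (nabla_covector alpha),
          weyl_compatible (ricci_tensor (M := M))
        & riemann_compatible (ricci_tensor (M := M))]].
Proof.
have [_ rec] := alpha_recurrent.
(* Compatibility concerns components chart by chart, so the local result is applied on each
   [img a]. *)
have key a := local_conformally_recurrent_compatible (@img_open _ _ M a)
  (@Defs.metric_smooth _ _ M a) (@Defs.metric_sym _ _ M a) (@Defs.metric_nondegenerate _ _ M a)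
  (@covec_smooth _ _ _ alpha a) n_ge5 (rec a).
split=> [a|a|a|closed]; try by have [] := key a.
by split=> a; have [_ _ _ /(_ (closed a))[]] := key a.
Qed.
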